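(* Let $\alpha = \omega \cdot m + k$ for some $m$ with $1 \leqslant m < \omega$ and some $k < \omega$, let $R$ be a binary relation on $\alpha$ with ${<}\subseteq R\subseteq{\leqslant}$, where $<$ is the membership relation on $\alpha$ and $\leqslant$ its reflexive closure, and let $L = \mathbf{L}(\alpha,R)$. Then satisfiability for $L$ is $\Sigma^1_1$-hard in languages with two individual variables, one monadic predicate letter and one proposition letter; that is, the set of formulas $\varphi$ containing only two individual variables, a single monadic predicate letter and a single proposition letter, with $\neg\varphi\notin L$, is $\Sigma^1_1$-hard.
   Context: First-order (predicate) modal language: countably many individual variables, predicate letters of every arity (nullary ones are proposition letters), no constants or function symbols, $\bot$, $\to$, $\Box$, $\forall$; other connectives, $\exists$, $\Diamond$ defined as usual. A predicate frame with expanding domains over a Kripke frame $\langle W,R\rangle$ is $\langle W,R,D\rangle$ with non-empty sets $D_w$ such that $wRw'$ implies $D_w\subseteq D_{w'}$. A model adds $I(w,P)\subseteq D_w^n$ for each $n$-ary letter $P$. Truth: atoms via $I(w,\cdot)$; Boolean connectives classically; $w\models^g\Box\varphi$ iff $v\models^g\varphi$ for all $R$-successors $v$ of $w$; $w\models^g\forall x\,\varphi$ iff $w\models^{g'}\varphi$ for all $x$-variants $g'$ of $g$ with $g'(x)\in D_w$. A formula is true at $w$ if true under all assignments sending its free variables into $D_w$. $\mathbf{L}(W,R)$ is the set of formulas true at all worlds of all models based on predicate frames with expanding domains over $\langle W,R\rangle$. Satisfiability for $L$ is the set of $\varphi$ with $\neg\varphi\notin L$. $\omega$ is the least infinite ordinal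 and $\omega\cdot m+k$ is ordinal arithmetic. *)

(* Defs.v *)
From Stdlib Require Import Relation_Operators.
From Stdlib Require Cantor.
From mathcomp Require Import all_boot.

Set Implicit Arguments.
Unset Strict Implicit.
Unset Printing Implicit Defensive.

(* Individual variables are natural numbers; [Atom i xs], with [xs] of length
   n, applies the i-th n-ary predicate letter (a proposition letter if n = 0). *)
Inductive form : Type :=
| Bot
| Atom (n i : nat) (xs : n.-tuple nat)
| Imp (phi psi : form)
| Box (phi : form)
| All (x : nat) (phi : form).

Definition Neg (phi : form) : form := Imp phi Bot.

Fixpoint free (x : nat) (phi : form) : bool :=
  match phi with
  | Bot => false
  | Atom _ _ xs => x \in xs
  | Imp phi psi => free x phi || free x psi
  | Box phi => free x phi
  | All y phi => (x != y) && free x phi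
  end.

(* All variables of a formula, including those merely quantified. *)
Fixpoint vars (phi : form) : seq nat :=
  match phi with
  | Bot => [::]
  | Atom _ _ xs => xs
  | Imp phi psi => vars phi ++ vars psi
  | Box phi => vars phi
  | All y phi => y :: vars phi
  end.

(* Predicate letters, as pairs (arity, index). *)
Fixpoint letters (phi : form) : seq (nat * nat) :=
  match phi with
  | Bot => [::]
  | Atom n i _ => [:: (n, i)]
  | Imp phi psi => letters phi ++ letters psi
  | Box phi => letters phi
  | All _ phi => letters phi
  end.

(* The language with variables x and y, the i-th monadic letter and the j-th
   proposition letter. *)
Definition in_language (x y i j : nat) (phi : form) : Prop :=
  {subset vars phi <= [:: x; y]} /\
  {subset letters phi <= [:: (1, i); (0, j)]}.

(* All the local domains are subsets of an ambient type, on which nothing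
   else depends: quantifiers at w range over D_w only. *)
Record frame (W : Type) (R : W -> W -> Prop) := Frame {
  carrier : Type;
  dom : W -> carrier -> Prop;
  dom_nonempty : forall w, exists d, dom w d;
  dom_expanding : forall w v, R w v -> forall d, dom w d -> dom v d
}.

Record model (W : Type) (R : W -> W -> Prop) := Model {
  base :> frame R;
  interp : W -> forall n : nat, nat -> n.-tuple (carrier base) -> Prop;
  interp_dom : forall w n i (t : n.-tuple (carrier base)),
    interp w i t -> forall l : 'I_n, dom w (tnth t l)
}.

Section Semantics.
Variables (W : Type) (R : W -> W -> Prop).

Fixpoint truth (M : model R) (w : W) (g : nat -> carrier M) (phi : form)
    : Prop :=
  match phi with
  | Bot => False
  | Atom _ i xs => interp w i (map_tuple g xs)
  | Imp phi psi => truth w g phi -> truth w g psi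
  | Box phi => forall v, R w v -> truth v g phi
  | All x phi => forall g' : nat -> carrier M,
      (forall z, z <> x -> g' z = g z) -> dom w (g' x) -> truth w g' phi
  end.

Definition true_at (M : model R) (w : W) (phi : form) : Prop :=
  forall g : nat -> carrier M,
    (forall x, free x phi -> dom w (g x)) -> truth w g phi.

Definition logic (phi : form) : Prop :=
  forall (M : model R) (w : W), true_at M w phi.

Definition satisfiable (phi : form) : Prop := ~ logic (Neg phi).

End Semantics.

(* m copies of omega placed one after the other (lexicographic order with the
   number of the copy as main component), followed by k points. *)
Definition ordinal_wmk (m k : nat) : Type := ('I_m * nat + 'I_k)%type.

Definition ordinal_lt (m k : nat) : ordinal_wmk m k -> ordinal_wmk m k -> Prop :=
  le_AsB ('I_m * nat) 'I_k
    (slexprod 'I_m nat (fun a b => a < b) (fun a b => a < b))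
    (fun a b => a < b).

Definition ordinal_le (m k : nat) : ordinal_wmk m k -> ordinal_wmk m k -> Prop :=
  clos_refl (ordinal_wmk m k) (@ordinal_lt m k).

(* Number variables are de Bruijn indices into a list of values (variables
   outside the list have value 0); set variables are named by naturals. *)
Inductive aterm : Type :=
| TVar (n : nat)
| TZero
| TSucc (s : aterm)
| TAdd (s t : aterm)
| TMul (s t : aterm).

(* Arithmetical formulas: no quantifiers over sets. *)
Inductive aform : Type :=
| AEq (s t : aterm)
| AMem (s : aterm) (X : nat)
| ABot
| AImp (a b : aform)
| AAll (a : aform).

Fixpoint aeval (e : seq nat) (s : aterm) : nat :=
  match s with
  | TVar n => nth 0 e n
  | TZero => 0
  | TSucc s => (aeval e s).+1
  | TAdd s t => aeval e s + aeval e t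
  | TMul s t => aeval e s * aeval e t
  end.

Fixpoint asat (X : nat -> nat -> Prop) (e : seq nat) (a : aform) : Prop :=
  match a with
  | AEq s t => aeval e s = aeval e t
  | AMem s i => X i (aeval e s)
  | ABot => False
  | AImp a b => asat X e a -> asat X e b
  | AAll a => forall n, asat X (n :: e) a
  end.

(* A formula mentions finitely many set variables, so quantifying over the
   whole family X is a finite block of existential set quantifiers. *)
Definition Sigma11 (B : nat -> Prop) : Prop :=
  exists a : aform,
    forall n, B n <-> exists X : nat -> nat -> Prop, asat X [:: n] a.

(* The least class of total functions containing zero, successor and the
   projections and closed under composition, primitive recursion and
   minimization of regular functions.  Each rule characterizes the function F
   pointwise, so the class is closed under extensional equality. *)
Inductive recursive : forall n : nat, (n.-tuple nat -> nat) -> Prop :=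
| rec_zero n (F : n.-tuple nat -> nat) :
    (forall t, F t = 0) -> recursive F
| rec_succ (F : 1.-tuple nat -> nat) :
    (forall t, F t = (thead t).+1) -> recursive F
| rec_proj n (l : 'I_n) (F : n.-tuple nat -> nat) :
    (forall t, F t = tnth t l) -> recursive F
| rec_comp n p (f : p.-tuple nat -> nat) (g : 'I_p -> n.-tuple nat -> nat)
    (F : n.-tuple nat -> nat) :
    recursive f -> (forall l, recursive (g l)) ->
    (forall t, F t = f [tuple g l t | l < p]) -> recursive F
| rec_prim n (f : n.-tuple nat -> nat) (h : n.+2.-tuple nat -> nat)
    (F : n.+1.-tuple nat -> nat) :
    recursive f -> recursive h ->
    (forall t, F (cons_tuple 0 t) = f t) ->
    (forall b t, F (cons_tuple b.+1 t) =
       h (cons_tuple b (cons_tuple (F (cons_tuple b t)) t))) ->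
    recursive F
| rec_min n (f : n.+1.-tuple nat -> nat) (F : n.-tuple nat -> nat) :
    recursive f ->
    (forall t, f (cons_tuple (F t) t) = 0) ->
    (forall t b, b < F t -> f (cons_tuple b t) <> 0) ->
    recursive F.

Definition many_one (B A : nat -> Prop) : Prop :=
  exists f : nat -> nat,
    recursive (fun t : 1.-tuple nat => f (thead t)) /\
    forall n, B n <-> A (f n).

Definition Sigma11_hard (A : nat -> Prop) : Prop :=
  forall B : nat -> Prop, Sigma11 B -> many_one B A.

Definition pair_code (a b : nat) : nat := Cantor.to_nat (a, b).

Fixpoint seq_code (s : seq nat) : nat :=
  if s is a :: s' then (pair_code a (seq_code s')).+1 else 0.

Fixpoint code (phi : form) : nat :=
  match phi with
  | Bot => pair_code 0 0
  | Atom n i xs => pair_code 1 (pair_code n (pair_code i (seq_code xs)))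
  | Imp phi psi => pair_code 2 (pair_code (code phi) (code psi))
  | Box phi => pair_code 3 (code phi)
  | All x phi => pair_code 4 (pair_code x (code phi))
  end.

Lemma pair_code_inj a b a' b' :
  pair_code a b = pair_code a' b' -> a = a' /\ b = b'.
Proof. by move/(can_inj Cantor.cancel_of_to)=> [-> ->]. Qed.

Lemma seq_code_inj : injective seq_code.
Proof.
by elim=> [|a s IHs] [|b s'] //= [] /pair_code_inj[-> /IHs ->].
Qed.

Lemma code_inj : injective code.
Proof.
elim=> [|n i xs|phi IH1 psi IH2|phi IH|x phi IH]
  [|n' i' xs'|phi' psi'|phi'|x' phi'] /= /pair_code_inj[] //.
- move=> _ /pair_code_inj[en] /pair_code_inj[<-] /seq_code_inj.
  by case: n' / en xs' => xs' /val_inj ->.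
- by move=> _ /pair_code_inj[/IH1-> /IH2->].
- by move=> _ /IH->.
- by move=> _ /pair_code_inj[-> /IH->].
Qed.

(* A set of formulas is Sigma^1_1-hard when the set of its Goedel numbers is. *)
Definition codes (S : form -> Prop) (n : nat) : Prop :=
  exists phi, S phi /\ code phi = n.

(* Main.v *)
From Stdlib Require Import ClassicalEpsilon Wellfounded.
From Stdlib Require Cantor.
Require Import Defs.
From mathcomp Require Import all_boot zify.

Set Implicit Arguments.
Unset Strict Implicit.
Unset Printing Implicit Defensive.

(* Let P be the monadic letter.  For an element d and a number n, the worlds
   from which P(d) can still alternate n times form an initial segment of the
   well-ordered set of worlds, and comparing such segments for two elements is
   expressible with two variables, whether or not worlds are reflexive.  The
   elements of the domain of a world thus behave as records with finitely many
   fields in a well-order, and the modal language contains first-order logic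
   with two variables over comparisons of fields.  That fields occur in
   decreasing order in a record is no restriction: the ranks of the intended
   values are stored in the total number of alternations of P(d).

   If moreover one field identifies the record, and each record is least or
   has an immediate predecessor, then the identities have order type omega,
   because a well-order without limit points does.  Records are then natural
   numbers, and fields are functions on them.  Reading numbers as pairs, two
   variables suffice to axiomatize addition, multiplication, the values of
   terms, and truth of an arithmetical formula in an environment coded by a
   number.  The sets are fields chosen freely.  To realize such records it is
   enough that the worlds start with a copy of omega, with P empty
   afterwards. *)

(** * Computability of formula contexts *)

Lemma recursive_comp1 n (f : nat -> nat) (F : n.-tuple nat -> nat) :
  recursive (fun t : 1.-tuple nat => f (thead t)) -> recursive F ->
  recursive (fun t => f (F t)).
Proof.
move=> recf recF; apply: (rec_comp (g := fun _ : 'I_1 => F) recf) => // t.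
by rewrite /thead tnth_mktuple.
Qed.

Lemma recursive_const n c : recursive (fun _ : n.-tuple nat => c).
Proof.
elim: c => [|c IHc]; first exact: rec_zero.
by apply: (recursive_comp1 (f := succn)) IHc; apply: rec_succ.
Qed.

Definition ord_one : 'I_2 := lift ord0 ord0.

Lemma recursive_comp2 n (f : nat -> nat -> nat) (F G : n.-tuple nat -> nat) :
  recursive (fun t : 2.-tuple nat => f (tnth t ord0) (tnth t ord_one)) ->
  recursive F -> recursive G -> recursive (fun t => f (F t) (G t)).
Proof.
move=> recf recF recG.
apply: (rec_comp (g := fun l : 'I_2 => if l == ord0 then F else G) recf) => [l|t].
  by case: ifP.
by rewrite !tnth_mktuple.
Qed.

Lemma recursive_add :
  recursive (fun t : 2.-tuple nat => tnth t ord0 + tnth t ord_one).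
Proof.
apply: (rec_prim (n := 1) (f := fun t => tnth t ord0)
  (h := fun t => (tnth t (lift ord0 ord0)).+1)).
- exact: rec_proj.
- apply: recursive_comp1; first exact: rec_succ.
  exact: rec_proj.
- by move=> t; rewrite tnth0 tnthS.
- by move=> b t; rewrite !(tnth0, tnthS).
Qed.

(** Written with [nat_rec] so as to be convertible with the recursion inside [Cantor.to_nat]. *)
Definition triangle : nat -> nat := nat_rec _ 0 (fun b c => b.+1 + c).

Lemma recursive_triangle : recursive (fun t : 1.-tuple nat => triangle (thead t)).
Proof.
apply: (rec_prim (n := 0) (f := fun=> 0)
  (h := fun t => (tnth t ord0).+1 + tnth t ord_one)) => //.
- exact: rec_zero.
- apply: (recursive_comp2 (f := addn) (F := fun t => (tnth t ord0).+1)).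
  + exact: recursive_add.
  + by apply: (recursive_comp1 (f := succn)); [exact: rec_succ | exact: rec_proj].
  + exact: rec_proj.
Qed.

Lemma recursive_pair_code n (F G : n.-tuple nat -> nat) :
  recursive F -> recursive G -> recursive (fun t => pair_code (F t) (G t)).
Proof.
move=> recF recG; rewrite /pair_code /Cantor.to_nat -/triangle.
apply: (recursive_comp2 (f := addn)) => //; first exact: recursive_add.
apply: recursive_comp1; first exact: recursive_triangle.
by apply: (recursive_comp2 (f := addn)) => //; exact: recursive_add.
Qed.

Lemma recursive_iter (h : nat -> nat) c :
  recursive (fun t : 1.-tuple nat => h (thead t)) ->
  recursive (fun t : 1.-tuple nat => iter (thead t) h c).
Proof.
move=> rech; apply: (rec_prim (n := 0) (f := fun=> c) (h := fun t => h (tnth t ord_one))).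
- exact: recursive_const.
- by apply: recursive_comp1 => //; exact: rec_proj.
- by [].
- by move=> b t; rewrite /ord_one !theadE tnthS tnth0.
Qed.

(** Acting on codes through a recursive function replaces recursion over syntax: the input number
    will enter the sentence only as the number of iterations of a fixed context. *)
Definition computable_context (C : form -> form) : Prop :=
  exists2 h : nat -> nat,
    recursive (fun t : 1.-tuple nat => h (thead t)) &
    forall phi, code (C phi) = h (code phi).

Lemma computable_context_id : computable_context id.
Proof. by exists id => //; exact: (@rec_proj _ ord0). Qed.

Lemma computable_context_const phi : computable_context (fun=> phi).
Proof. by exists (fun=> code phi) => //; exact: recursive_const. Qed.

Lemma computable_context_imp C1 C2 :
  computable_context C1 -> computable_context C2 ->
  computable_context (fun phi => Imp (C1 phi) (C2 phi)).
Proof.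
move=> [h1 rec1 E1] [h2 rec2 E2].
exists (fun c => pair_code 2 (pair_code (h1 c) (h2 c))) => [|phi].
  by apply: recursive_pair_code (recursive_const _ _) _; apply: recursive_pair_code.
by rewrite /= E1 E2.
Qed.

Lemma computable_context_all x C :
  computable_context C -> computable_context (fun phi => All x (C phi)).
Proof.
move=> [h rech E].
exists (fun c => pair_code 4 (pair_code x (h c))) => [|phi].
  apply: recursive_pair_code (recursive_const _ _) _.
  by apply: recursive_pair_code rech; apply: recursive_const.
by rewrite /= E.
Qed.

Lemma recursive_code_iter C D phi :
  computable_context C -> computable_context D ->
  recursive (fun t : 1.-tuple nat => code (C (iter (thead t) D phi))).
Proof.
move=> [h rech Eh] [k reck Ek].
have E n : code (C (iter n D phi)) = h (iter n k (code phi)).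
  by rewrite Eh; congr h; elim: n => //= n <-; rewrite Ek.
apply: (rec_comp (f := fun t : 1.-tuple nat => h (thead t))
  (g := fun=> fun t => iter (thead t) k (code phi))) => // [_|t].
  exact: recursive_iter.
by rewrite E /thead tnth_mktuple.
Qed.

(** * Two-variable logic of records *)

(* [FLe i u j v] compares the i-th register of the variable [u] with the j-th
   register of the variable [v]; the two variables are the booleans. *)
Inductive fo2 : Type :=
| FLe (i : nat) (u : bool) (j : nat) (v : bool)
| FBot
| FImp (p q : fo2)
| FAll (u : bool) (p : fo2).

Definition FNot (p : fo2) : fo2 := FImp p FBot.
Definition FAnd (p q : fo2) : fo2 := FNot (FImp p (FNot q)).
Definition FEx (u : bool) (p : fo2) : fo2 := FNot (FAll u (FNot p)).
Definition FEq (i : nat) (u : bool) (j : nat) (v : bool) : fo2 :=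
  FAnd (FLe i u j v) (FLe j v i u).

Fixpoint FAndN (n : nat) (p : nat -> fo2) : fo2 :=
  if n is n'.+1 then FAnd (p n') (FAndN n' p) else FNot FBot.

Definition update (D : Type) (e : bool -> D) (u : bool) (d : D) : bool -> D :=
  fun v => if v == u then d else e v.

Fixpoint fsat (D : Type) (dm : D -> Prop) (le : nat -> D -> nat -> D -> Prop)
    (e : bool -> D) (p : fo2) : Prop :=
  match p with
  | FLe i u j v => le i (e u) j (e v)
  | FBot => False
  | FImp p q => fsat dm le e p -> fsat dm le e q
  | FAll u p => forall d, dm d -> fsat dm le (update e u d) p
  end.

(* A strict upper bound. *)
Fixpoint registers (p : fo2) : nat :=
  match p with
  | FLe i _ j _ => (maxn i j).+1
  | FBot => 0
  | FImp p q => maxn (registers p) (registers q)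
  | FAll _ p => registers p
  end.

Section Satisfaction.
Variables (D : Type) (dm : D -> Prop) (le : nat -> D -> nat -> D -> Prop).
Implicit Types (e : bool -> D) (p q : fo2).

Lemma fsat_not e p : fsat dm le e (FNot p) <-> ~ fsat dm le e p.
Proof. by []. Qed.

Lemma fsat_imp e p q :
  fsat dm le e (FImp p q) <-> (fsat dm le e p -> fsat dm le e q).
Proof. by []. Qed.

Lemma fsat_all e u p :
  fsat dm le e (FAll u p) <-> forall d, dm d -> fsat dm le (update e u d) p.
Proof. by []. Qed.

Lemma fsat_and e p q :
  fsat dm le e (FAnd p q) <-> fsat dm le e p /\ fsat dm le e q.
Proof.
split=> [/fsat_not H|[Hp Hq] /= H]; last exact: H.
by split; apply: NNPP => H'; apply: H => Hp; [case: H'|exact: H'].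
Qed.

Lemma fsat_ex e u p :
  fsat dm le e (FEx u p) <-> exists d, dm d /\ fsat dm le (update e u d) p.
Proof.
split=> [/fsat_not H|[d [dmd Hd]] /= H]; last exact: H dmd Hd.
by apply: NNPP => H'; apply: H => d dmd Hd; apply: H'; exists d.
Qed.

Lemma fsat_andN e n (p : nat -> fo2) :
  fsat dm le e (FAndN n p) <-> forall i, i < n -> fsat dm le e (p i).
Proof.
elim: n => [|n IHn]; first by split=> [_ i|_ []].
rewrite [FAndN _ _]/= fsat_and IHn; split=> [[Hn H] i|H].
  by rewrite ltnS leq_eqVlt => /predU1P[->|/H].
by split=> [|i Hi]; apply: H; rewrite // ltnS ltnW.
Qed.

Lemma fsat_eq e i u j v :
  fsat dm le e (FEq i u j v) <-> le i (e u) j (e v) /\ le j (e v) i (e u).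
Proof. exact: fsat_and. Qed.

End Satisfaction.

Lemma registers_and p q : registers (FAnd p q) = maxn (registers p) (registers q).
Proof. by rewrite /= !maxn0. Qed.

Lemma registers_ex u p : registers (FEx u p) = registers p.
Proof. by rewrite /= !maxn0. Qed.

Lemma registers_eq i u j v : registers (FEq i u j v) = (maxn i j).+1.
Proof. by rewrite registers_and /= [maxn j i]maxnC maxnn. Qed.

Lemma registers_andN n (p : nat -> fo2) k :
  (forall i, i < n -> registers (p i) <= k) -> registers (FAndN n p) <= k.
Proof.
elim: n => //= n IHn H; rewrite !geq_max H // IHn //= => i Hi.
by apply: H; rewrite ltnS ltnW.
Qed.

(** Elements are seen only through comparisons of registers, so [N] may identify records; its
    surjectivity serves the quantifiers. *)
Lemma fsat_transfer (D E : Type) (dm : D -> Prop) (dmE : E -> Prop) leD leE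
    (N : D -> E) k :
  (forall d, dm d -> dmE (N d)) ->
  (forall a, dmE a -> exists2 d, dm d & N d = a) ->
  (forall i j d d', i < k -> j < k -> dm d -> dm d' ->
     leD i d j d' <-> leE i (N d) j (N d')) ->
  forall p (e : bool -> D) (e' : bool -> E), registers p <= k ->
    (forall u, dm (e u)) -> (forall u, e' u = N (e u)) ->
    fsat dm leD e p <-> fsat dmE leE e' p.
Proof.
move=> dmN surjN leN; elim=> [i u j v||p IHp q IHq|u p IHp] e e' /=.
- by rewrite gtn_max => /andP[ik jk] dme He; rewrite !He; apply: leN.
- by [].
- rewrite geq_max => /andP[pk qk] dme He.
  by rewrite (IHp e e' pk dme He) (IHq e e' qk dme He).
- move=> pk dme He.
  have step d : dm d -> fsat dm leD (update e u d) p <->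
      fsat dmE leE (update e' u (N d)) p.
    by move=> dmd; apply: IHp => // v; rewrite /update; case: eqP.
  split=> [H a /surjN[d dmd <-]|H d dmd]; first by apply/(step _ dmd)/H.
  by apply/(step _ dmd)/H/dmN.
Qed.

(* Register 0 identifies an element; registers 1 and 2 are its successor and
   the least identity.  Over a well-order these axioms force the identities
   into order type omega, as every one is least or a successor. *)
Definition standard (k : nat) : fo2 :=
  FAnd (FAndN k (fun i => FAll true (FEx false (FEq 0 false i true))))
 (FAnd (FAndN k (fun i => FAll true (FAll false
          (FImp (FEq 0 true 0 false) (FEq i true i false)))))
 (FAnd (FAll true (FNot (FLe 1 true 0 true)))
 (FAnd (FAll true (FAll false (FLe 2 true 0 false)))
       (FAll true (FImp (FNot (FAll false (FLe 0 true 0 false)))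
          (FEx false (FEq 1 false 0 true))))))).

Lemma registers_standard k : 2 < k -> registers (standard k) <= k.
Proof.
move=> k2; rewrite /standard /FAnd /= !geq_max /=.
rewrite !registers_andN => [|i ik|i ik]; rewrite /= ?geq_max; lia.
Qed.

Definition nat_le (f : nat -> nat -> nat) (i a j b : nat) : Prop := f i a <= f j b.

Definition normal_structure (f : nat -> nat -> nat) : Prop :=
  forall a, [/\ f 0 a = a, f 1 a = a.+1 & f 2 a = 0].

Lemma fsat_nat_eq f e i u j v :
  fsat (fun=> True) (nat_le f) e (FEq i u j v) <-> f i (e u) = f j (e v).
Proof. by rewrite fsat_eq /nat_le; split=> [[]|->]; lia. Qed.

Lemma standard_normal k f e :
  normal_structure f -> fsat (fun=> True) (nat_le f) e (standard k).
Proof.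
move=> nf.
have f0 a : f 0 a = a by case: (nf a).
have f1 a : f 1 a = a.+1 by case: (nf a).
have f2 a : f 2 a = 0 by case: (nf a).
rewrite /standard !fsat_and !fsat_andN; split=> [i _|].
  apply/fsat_all => a _; apply/fsat_ex; exists (f i a); split=> //.
  by apply/fsat_nat_eq; rewrite /update /= f0.
split=> [i _|].
  apply/fsat_all => a _; apply/fsat_all => b _; apply/fsat_imp.
  by rewrite !fsat_nat_eq /update /= !f0 => ->.
split=> [a _|]; first by rewrite /= /nat_le /update /= f0 f1 ltnn.
split=> [a _ b _|]; first by rewrite /= /nat_le f2.
(* As [a] is not least, it is positive, and [a.-1] is a true predecessor. *)
apply/fsat_all => a _; apply/fsat_imp => H; apply/fsat_ex; exists a.-1; split=> //.
apply/fsat_nat_eq; rewrite /update /= f1 f0; case: a H => // H; case: H => b _.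
by rewrite /= /nat_le /update /= !f0.
Qed.

(** * Well-ordered records satisfying [standard] are the natural numbers *)

Section Standardness.
Variables (W : Type) (lt : W -> W -> Prop).
Hypothesis lt_wf : well_founded lt.
Hypothesis lt_total : forall u v, [\/ lt u v, u = v | lt v u].
Variables (D : Type) (dm : D -> Prop) (seg : nat -> D -> W -> Prop).
Hypothesis dm_nonempty : exists d, dm d.
Hypothesis seg_down : forall i d u v, lt u v -> seg i d v -> seg i d u.

Definition seg_le (i : nat) (d : D) (j : nat) (d' : D) : Prop :=
  forall w, seg i d w -> seg j d' w.

Lemma seg_le_trans i d j d' l d'' :
  seg_le i d j d' -> seg_le j d' l d'' -> seg_le i d l d''.
Proof. by move=> H H' w /H /H'. Qed.

Lemma not_seg_le i d j d' :
  ~ seg_le i d j d' -> exists2 w, seg i d w & ~ seg j d' w.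
Proof.
move=> H; apply: NNPP => H'; apply: H => w Hw.
by apply: NNPP => Hw'; apply: H'; exists w.
Qed.

Lemma seg_lt_of_mem i d w w' :

  seg i d w' -> ~ seg i d w -> lt w' w.
Proof.
move=> Hw' Hw; case: (lt_total w' w) => // [E|Hlt].
  by case: Hw; rewrite -E.
by case: Hw; apply: seg_down Hlt Hw'.
Qed.

Lemma seg_le_total i d j d' : seg_le i d j d' \/ seg_le j d' i d.
Proof.
apply: NNPP => /not_or_and[/not_seg_le[w Hw Hw'] /not_seg_le[v Hv Hv']].
case: (lt_total w v) => [Hlt|E|Hlt].
- by apply: Hw'; apply: seg_down Hlt Hv.
- by apply: Hw'; rewrite E.
- by apply: Hv'; apply: seg_down Hlt Hw.
Qed.

Variables (k : nat) (e0 : bool -> D).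
Hypothesis k2 : 2 < k.
Hypothesis std : fsat dm seg_le e0 (standard k).

Definition seg_eq (i : nat) (d : D) (j : nat) (d' : D) : Prop := seg_le i d j d' /\ seg_le j d' i d.

(** Here [n] counts the predecessor steps down to a least identity. Several records may share a
    number, as they may share an identity. *)
Fixpoint numbered (n : nat) (d : D) : Prop :=
  dm d /\ if n is n'.+1 then exists2 d', numbered n' d' & seg_eq 1 d' 0 d
          else forall d', dm d' -> seg_le 0 d 0 d'.

Lemma numbered_dm n d : numbered n d -> dm d.
Proof. by case: n => [|n] []. Qed.

Lemma identity_exists i d : i < k -> dm d -> exists2 d', dm d' & seg_eq 0 d' i d.
Proof.
move=> ik dmd; case/fsat_and: std => /fsat_andN /(_ i ik) /fsat_all /(_ d dmd) /fsat_ex.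
by case=> d' [dmd' /fsat_eq H] _; exists d'.
Qed.

Lemma identity_determines i d d' : i < k -> dm d -> dm d' ->
  seg_eq 0 d 0 d' -> seg_eq i d i d'.
Proof.
move=> ik dmd dmd' H; case/fsat_and: std => _ /fsat_and[+ _].
move/fsat_andN/(_ i ik)/fsat_all/(_ d dmd)/fsat_all/(_ d' dmd')/fsat_imp.
by rewrite !fsat_eq; apply.
Qed.

Lemma succ_above d : dm d -> ~ seg_le 1 d 0 d.
Proof.
by case/fsat_and: std => _ /fsat_and[_] /fsat_and[+ _] => H dmd; apply: (H d dmd).
Qed.

Lemma zero_least d d' : dm d -> dm d' -> seg_le 2 d 0 d'.
Proof.
case/fsat_and: std => _ /fsat_and[_] /fsat_and[_] /fsat_and[+ _] => H dmd dmd'.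
exact: (H d dmd d' dmd').
Qed.

Lemma zero_or_succ d : dm d ->
  (forall d', dm d' -> seg_le 0 d 0 d') \/ exists2 d', dm d' & seg_eq 1 d' 0 d.
Proof.
case/fsat_and: std => _ /fsat_and[_] /fsat_and[_] /fsat_and[_ H] dmd.
case: (classic (forall d', dm d' -> seg_le 0 d 0 d')) => [|Hd]; first by left.
right; move/fsat_all/(_ d dmd)/fsat_imp/(_ Hd)/fsat_ex: H => [d' [dmd' /fsat_eq H]].
by exists d'.
Qed.

(** A predecessor omits some world of the segment of its successor, so each step to a predecessor
    moves an omitted world strictly down. Well-foundedness stops this descent at a least
    identity. *)
Lemma numbered_exists d : dm d -> exists n, numbered n d.
Proof.
have pred_lt d' d1 : dm d' -> seg_eq 1 d' 0 d1 -> exists2 w, seg 0 d1 w & ~ seg 0 d' w.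
  move=> dmd' [H _]; apply: not_seg_le => H'.
  exact: succ_above dmd' (seg_le_trans H H').
have bounded w : forall d, dm d -> ~ seg 0 d w -> exists n, numbered n d.
  elim/(well_founded_ind lt_wf): w => w IHw d1 dmd1 Hw.
  case: (zero_or_succ dmd1) => [Hd1|[d' dmd' Hd']]; first by exists 0.
  have [w' Hw' Hw''] := pred_lt _ _ dmd' Hd'.
  have [|n Hn] := IHw w' _ d' dmd' Hw''; first exact: seg_lt_of_mem Hw' Hw.
  by exists n.+1; split=> //; exists d'.
(* The segment of [d] may contain every world, so a first predecessor step is made to obtain an
   omitted one. *)
move=> dmd; case: (zero_or_succ dmd) => [Hd|[d' dmd' Hd']]; first by exists 0.
have [w _ /bounded[]// n Hn] := pred_lt _ _ dmd' Hd'.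
by exists n.+1; split=> //; exists d'.
Qed.

Lemma numbered_inhabited n : exists d, numbered n d.
Proof.
elim: n => [|n [d Hd]].
  have [d dmd] := dm_nonempty; have [d' dmd' [Hd' _]] := identity_exists k2 dmd.
  exists d'; split=> // d'' dmd''.
  exact: seg_le_trans Hd' (zero_least dmd dmd'').
have [d' dmd' [H H']] := identity_exists (ltnW k2) (numbered_dm Hd).
by exists d'; split=> //; exists d.
Qed.

(** For equal numbers this is an induction, as register 1 depends only on the identity. Beyond that,
    a successor lies above its record, by [succ_above] and totality. *)
Lemma seg_le_of_leq n m d d' :
  numbered n d -> numbered m d' -> n <= m -> seg_le 0 d 0 d'.
Proof.
have eqP n1 : forall d d', numbered n1 d -> numbered n1 d' -> seg_le 0 d 0 d'.
  elim: n1 => [|n1 IHn] d1 d2 [dm1 H1] [dm2 H2]; first exact: H1.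
  case: H1 H2 => c1 num1 [_ E1] [c2 num2 [E2 _]].
  apply: seg_le_trans E1 (seg_le_trans _ E2).
  by case: (@identity_determines 1 c1 c2 (ltnW k2) (numbered_dm num1)
    (numbered_dm num2)) => //; split; apply: IHn.
move=> num num'; elim: m d' num' => [|m IHm] d' num'.
  by case: n num => // num _; apply: eqP num num'.
rewrite leq_eqVlt => /predU1P[En|/ltnSE nm]; first by subst n; apply: eqP num num'.
case: num' => dmd' [c numc [E _]].
apply: seg_le_trans (IHm _ numc nm) (seg_le_trans _ E).
by case: (seg_le_total 1 c 0 c) => // /(succ_above (numbered_dm numc)).
Qed.

Lemma leq_of_seg_le n m d d' :
  numbered n d -> numbered m d' -> seg_le 0 d 0 d' -> n <= m.
Proof.
move=> num num' le; rewrite leqNgt; apply/negP => mn.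
case: n num mn => // n [dmd [c numc [E _]]]; rewrite ltnS => mn.
apply: (succ_above (numbered_dm numc)).
exact: seg_le_trans E (seg_le_trans le (seg_le_of_leq num' numc mn)).
Qed.

(** The number [f i a] is that of any record whose identity is the value of register [i] in a record
    numbered [a]. *)
Lemma normal_structure_of_standard :
  exists f N, [/\ normal_structure f,
    forall a : nat, exists2 d, dm d & N d = a &
    forall i j d d', i < k -> j < k -> dm d -> dm d' ->
      seg_le i d j d' <-> nat_le f i (N d) j (N d')].
Proof.
have [d0 dm0] := dm_nonempty.
have [N HN] : exists N, forall d, dm d -> numbered (N d) d.
  have H d : exists n, dm d -> numbered n d.
    case: (classic (dm d)) => [/numbered_exists[n Hn]|Hd]; first by exists n.
    by exists 0.
  exists (fun d => proj1_sig (constructive_indefinite_description _ (H d))).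
  by move=> d; case: constructive_indefinite_description.
have numbered_uniq n d : numbered n d -> N d = n.
  move=> num; have num' := HN _ (numbered_dm num).
  by apply/anti_leq; rewrite (leq_of_seg_le num' num (fun _ => id))
    (leq_of_seg_le num num' (fun _ => id)).
have surjN a : exists2 d, dm d & N d = a.
  by have [d num] := numbered_inhabited a; exists d; [exact: numbered_dm num|exact: numbered_uniq].
have [f Hf] : exists f : nat -> nat -> nat, forall i a d d', i < k ->
    numbered a d -> dm d' -> seg_eq 0 d' i d -> f i a = N d'.
  (* The choice of records is immaterial: equal numbers give equal identities, hence equal values of
     each register below [k]. *)
  have H i a : exists n, forall d d', i < k ->
    numbered a d -> dm d' -> seg_eq 0 d' i d -> n = N d'.
    case: (boolP (i < k)) => [ik|_]; last by exists 0.
    have [d num] := numbered_inhabited a.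
    have [d' dmd' [E E']] := identity_exists ik (numbered_dm num).
    exists (N d') => d1 d1' _ num1 dmd1' [E1 E1'].
    have [H1 H2] : seg_eq i d i d1.
      by apply: identity_determines (numbered_dm num) (numbered_dm num1) _ => //;
        split; [apply: seg_le_of_leq num num1 _|apply: seg_le_of_leq num1 num _].
    apply/eqP; rewrite eqn_leq; apply/andP; split.
      apply: (leq_of_seg_le (HN _ dmd') (HN _ dmd1')).
      exact: seg_le_trans E (seg_le_trans H1 E1').
    apply: (leq_of_seg_le (HN _ dmd1') (HN _ dmd')).
    exact: seg_le_trans E1 (seg_le_trans H2 E').
  exists (fun i a => proj1_sig (constructive_indefinite_description _ (H i a))).
  by move=> i a; case: constructive_indefinite_description.
exists f, N; split=> // [a|i j d d' ik jk dmd dmd'].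
  have [d num] := numbered_inhabited a; have dmd := numbered_dm num.
  split.
  - by rewrite (Hf 0 a d d) ?(numbered_uniq a) ?(leq_ltn_trans _ k2); last split.
  - have [d' dmd' E] := identity_exists (ltnW k2) dmd.
    rewrite (Hf 1 a d d') ?(ltnW k2) //; apply: numbered_uniq; split=> //.
    by exists d => //; case: E.
  - have [d' num'] := numbered_inhabited 0; have dmd' := numbered_dm num'.
    have [c dmc [E E']] := identity_exists k2 dmd.
    rewrite (Hf 2 a d c) //; apply: numbered_uniq; split=> // d'' dmd''.
    exact: seg_le_trans E (zero_least dmd dmd'').
have [c dmc [E E']] := identity_exists ik dmd.
have [c' dmc' [F F']] := identity_exists jk dmd'.
rewrite /nat_le (Hf i _ d c) ?(Hf j _ d' c') //; try exact: HN.
split=> [H|H].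
  apply: leq_of_seg_le (HN _ dmc) (HN _ dmc') _.
  exact: seg_le_trans E (seg_le_trans H F').
exact: seg_le_trans E' (seg_le_trans (seg_le_of_leq (HN _ dmc) (HN _ dmc') H) F).
Qed.

End Standardness.

(** * Translation into the modal language *)

(** The entries above [w] form a prefix of a strictly decreasing list; the default 0 of [nth] keeps
    the equation true past the end. *)
Lemma count_ltn_sorted (s : seq nat) w n :
  sorted gtn s -> (n < count (ltn w) s) = (w < nth 0 s n).
Proof.
elim: s n => [|a s IHs] n /= Hs; first by rewrite nth_nil.
have Hs' := path_sorted Hs.
have Hall : all (gtn a) s by apply: order_path_min Hs => ? ? ?; lia.
case: (ltnP w a) => wa; first by case: n => [|n]; rewrite /= ?wa ?add1n // ltnS IHs.
have -> : count (ltn w) s = 0.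
  by apply/eqP; rewrite -leqn0 leqNgt -has_count; apply/hasPn => b /(allP Hall) /=; lia.
case: n => [|n] /=; first lia.
by case: (ltnP n (size s)) => [/(mem_nth 0)/(allP Hall)/=|/(nth_default 0)->]; lia.
Qed.

(* Codes, as numbers at least k, of the maps from k registers to their ranks
   in decreasing order. *)
Definition rank_tags (k : nat) : seq (seq nat) :=
  [seq map val (tval t) | t <- enum {: k.-tuple 'I_k}].
Definition rank_tag (k l i : nat) : nat := nth 0 (nth [::] (rank_tags k) (l - k)) i.
Definition rank_tag_bound (k : nat) : nat := k + size (rank_tags k).

Lemma mem_rank_tags k (s : seq nat) : size s = k -> all (gtn k) s -> s \in rank_tags k.
Proof.
move=> sz Hs; apply/mapP.
have lt_nth (l : 'I_k) : nth 0 s l < k by move/all_nthP: Hs => /(_ 0 l); rewrite sz; apply.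
exists [tuple Ordinal (lt_nth l) | l < k]; first by rewrite mem_enum.
apply: (@eq_from_nth _ 0) => [|i Hi]; first by rewrite size_map size_tuple.
rewrite sz in Hi; rewrite (nth_map (Ordinal (lt_nth (Ordinal Hi)))) ?size_tuple //=.
rewrite (nth_map (Ordinal Hi)) ?size_enum_ord //=.
by rewrite nth_enum_ord.
Qed.

(** The distinct values are listed in decreasing order, and the length of the list encodes which
    position belongs to which register. The common shift preserves comparisons and leaves room for
    padding below. *)
Lemma tagged_sequence k (v : nat -> nat) :
  exists s, [/\ sorted gtn s, all (ltn 0) s, size s < rank_tag_bound k &
    forall i, i < k -> nth 0 s (rank_tag k (size s) i) = v i + rank_tag_bound k].
Proof.
set T := rank_tag_bound k.
pose s0 := sort geq (undup [seq v i | i <- iota 0 k]).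
have mem_s0 i : i < k -> v i \in s0.
  by move=> ik; rewrite mem_sort mem_undup map_f // mem_iota.
have size_s0 : size s0 <= k.
  by rewrite size_sort (leq_trans (size_undup _)) // size_map size_iota.
pose idx := [seq index (v i) s0 | i <- iota 0 k].
have idx_rank_tags : idx \in rank_tags k.
  apply: mem_rank_tags; first by rewrite size_map size_iota.
  apply/allP => a /mapP[i]; rewrite mem_iota => /andP[_ ik] ->.
  by rewrite /= (leq_trans _ size_s0) // index_mem mem_s0.
pose r := index idx (rank_tags k).
(* The padding is positive and stays below [T], hence below all shifted values; it brings the length
   to exactly [k + r]. *)
pose s := [seq a + T | a <- s0] ++ rev (iota 1 (k - size s0 + r)).
have size_s : size s = k + r by rewrite size_cat size_map size_rev size_iota; lia.
have r_lt : r < size (rank_tags k) by rewrite index_mem.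
exists s; split.
- have gtn_trans : transitive gtn by move=> ? ? ?; lia.
  rewrite (sorted_pairwise gtn_trans) pairwise_cat -!(sorted_pairwise gtn_trans).
  apply/and3P; split.
  + apply/allrelP => a b /mapP[c _ ->]; rewrite mem_rev mem_iota /T /rank_tag_bound /=; lia.
  + rewrite sorted_map (@eq_sorted _ _ gtn) ?gtn_sorted_uniq_geq => [|a b]; last by rewrite /=; lia.
    rewrite sort_uniq undup_uniq sort_sorted // => a b; rewrite /=; lia.
  + by rewrite rev_sorted iota_ltn_sorted.
- apply/allP => a; rewrite mem_cat mem_rev mem_iota => /orP[/mapP[b _ ->]|];
    rewrite /= /T /rank_tag_bound; lia.
- by rewrite size_s ltn_add2l.
- move=> i ik; rewrite /rank_tag size_s addKn nth_index // (nth_map 0) ?size_iota //.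
  rewrite nth_iota // add0n.
  have lt_idx : index (v i) s0 < size s0 by rewrite index_mem mem_s0.
  by rewrite nth_cat size_map lt_idx (nth_map 0) // nth_index // mem_s0.
Qed.

(** * Modal formulas that count alternations and compare registers *)

Section Syntax.
Variables x y letter : nat.

Definition var (u : bool) : nat := if u then y else x.
Definition Mark (u : bool) : form := Atom letter [tuple var u].
Definition Conj (phi psi : form) : form := Neg (Imp phi (Neg psi)).
(* Now or at a successor, so that reflexivity of the worlds is immaterial. *)
Definition Eventually (phi : form) : form := Imp (Neg phi) (Neg (Box (Neg phi))).
Definition Always (phi : form) : form := Conj phi (Box phi).

Fixpoint ConjN (n : nat) (F : nat -> form) : form :=
  if n is n'.+1 then Conj (F n') (ConjN n' F) else Neg Bot.

(* Alternations are counted from the last one, which is to a world where [u] is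
   marked; so the parity of the count tells whether [u] is marked. *)
Fixpoint Alt (n : nat) (u : bool) : form :=
  if n is n'.+1 then
    Eventually (Conj (if odd n' then Neg (Mark u) else Mark u) (Alt n' u))
  else Neg Bot.

Definition Length (l : nat) (u : bool) : form := Conj (Alt l u) (Neg (Alt l.+1 u)).

Variable k : nat.

(** All pairs of lengths are tried, because the length determines the ranks of the registers. A
    register of rank [r] is the segment of worlds with at least [r.+1] alternations ahead, and
    [Always] expresses inclusion of such segments. *)
Definition RegisterLe (i : nat) (u : bool) (j : nat) (v : bool) : form :=
  ConjN (rank_tag_bound k) (fun l => ConjN (rank_tag_bound k) (fun l' =>
    Imp (Length l u) (Imp (Length l' v)
      (Always (Imp (Alt (rank_tag k l i).+1 u) (Alt (rank_tag k l' j).+1 v)))))).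

Fixpoint translate (p : fo2) : form :=
  match p with
  | FLe i u j v => RegisterLe i u j v
  | FBot => Bot
  | FImp p q => Imp (translate p) (translate q)
  | FAll u p => All (var u) (translate p)
  end.

(** The first conjunct bounds the length of every element of the domain, so that the finite
    conjunctions in [RegisterLe] cover all cases. *)
Definition modal_sentence (p : fo2) : form :=
  All x (All y (Conj (Neg (Alt (rank_tag_bound k) false)) (translate p))).

Section Language.
Variable j : nat.
Notation lang := (in_language x y letter j).

Lemma language_bot : lang Bot.
Proof. by []. Qed.

Lemma language_imp phi psi : lang phi -> lang psi -> lang (Imp phi psi).
Proof. by move=> [v1 l1] [v2 l2]; split=> a; rewrite mem_cat => /orP[]; auto. Qed.

Lemma language_box phi : lang phi -> lang (Box phi).
Proof. by []. Qed.

Lemma var_language u : var u \in [:: x; y].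
Proof. by case: u; rewrite !inE eqxx ?orbT. Qed.

Lemma language_all u phi : lang phi -> lang (All (var u) phi).
Proof.
by move=> [v l]; split=> // a; rewrite inE => /predU1P[->|/v//]; apply: var_language.
Qed.

Lemma language_mark u : lang (Mark u).
Proof.
split=> a; rewrite inE => /eqP->; first exact: var_language.
by rewrite !inE eqxx.
Qed.

#[local] Hint Resolve language_bot language_imp language_box language_all language_mark : core.

Lemma language_conjN n F : (forall l, lang (F l)) -> lang (ConjN n F).
Proof. by move=> H; elim: n => [|n IHn] /=; rewrite /Conj /Neg; auto. Qed.

Lemma language_alt n u : lang (Alt n u).
Proof.
elim: n => [|n IHn] /=; rewrite /Eventually /Conj /Neg; first by auto.
by case: (odd n); auto 10.
Qed.

#[local] Hint Resolve language_conjN language_alt : core.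

Lemma language_translate p : lang (translate p).
Proof.
elim: p => [i u i' v||p IHp q IHq|u p IHp] /=; auto.
do 2!apply: language_conjN => ?; rewrite /Length /Always /Conj /Neg.
by auto 20.
Qed.

Lemma language_modal_sentence p : lang (modal_sentence p).
Proof.
apply: (language_all false); apply: (language_all true); rewrite /Conj /Neg.
by have := language_translate p; auto 10.
Qed.

End Language.
End Syntax.

(** * Truth of translated formulas over a well-order of worlds *)

Section Semantics.
Variables (W : Type) (lt R : W -> W -> Prop).
Hypothesis lt_R : forall u v, lt u v -> R u v.
Hypothesis R_le : forall u v, R u v -> lt u v \/ u = v.
Hypothesis lt_trans : forall u v w, lt u v -> lt v w -> lt u w.
Hypothesis lt_wf : well_founded lt.
Hypothesis lt_total : forall u v, [\/ lt u v, u = v | lt v u].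
Variables x y letter : nat.
Hypothesis x_neq_y : x <> y.

Definition lte u v : Prop := lt u v \/ u = v.

Lemma lte_trans u v w : lte u v -> lte v w -> lte u w.
Proof.
move=> [uv|->] // [vw|<-]; left => //; exact: lt_trans uv vw.
Qed.

Section Truth.
Variable M : model R.
Implicit Types (g : nat -> carrier M) (d : carrier M).

Lemma truth_conj w g phi psi :
  truth w g (Conj phi psi) <-> truth w g phi /\ truth w g psi.
Proof.
split=> [/= H|[H1 H2] /= H]; last exact: H.
by split; apply: NNPP => H'; apply: H => H1; [case: H'|exact: H'].
Qed.

Lemma truth_imp w g phi psi :
  truth w g (Imp phi psi) <-> (truth w g phi -> truth w g psi).
Proof. by []. Qed.

Lemma truth_eventually w g phi :
  truth w g (Eventually phi) <-> exists2 v, lte w v & truth v g phi.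
Proof.
split=> [/= H|[v [wv|<-] Hv] /= H].
- apply: NNPP => H'; apply: H => [H|v /R_le wv Hv]; apply: H'.
    by exists w => //; right.
  by exists v.
- by move/(_ v (lt_R wv)); apply.
- by case: (H Hv).
Qed.

Lemma truth_always w g phi :
  truth w g (Always phi) <-> forall v, lte w v -> truth v g phi.
Proof.
rewrite truth_conj; split=> [[H H'] v [/lt_R/H'|<-]|H] //.
by split=> [|v /R_le]; [apply: H; right|apply: H].
Qed.

Lemma truth_conjN w g n F :
  truth w g (ConjN n F) <-> forall l, l < n -> truth w g (F l).
Proof.
elim: n => [|n IHn]; first by split=> [_ l|_ []].
rewrite [ConjN _ _]/= truth_conj IHn; split=> [[Hn H] l|H].
  by rewrite ltnS leq_eqVlt => /predU1P[->|/H].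
by split=> [|l Hl]; apply: H; rewrite // ltnS ltnW.
Qed.

Definition marked w d : Prop := interp w letter [tuple d].

Fixpoint alternates (n : nat) (w : W) (d : carrier M) : Prop :=
  if n is n'.+1 then
    exists2 v, lte w v &
      (if odd n' then ~ marked v d else marked v d) /\ alternates n' v d
  else True.

Lemma truth_mark w g u : truth w g (Mark x y letter u) <-> marked w (g (var x y u)).
Proof.
rewrite /= /marked.
by have -> : map_tuple g [tuple var x y u] = [tuple g (var x y u)] by apply: val_inj.
Qed.

Lemma truth_alt n w g u :
  truth w g (Alt x y letter n u) <-> alternates n w (g (var x y u)).
Proof.
elim: n w => [|n IHn] w; first by split=> // _ [].
rewrite [Alt _ _ _ _ _]/= truth_eventually /=.
have E v : truth v g (Conj (if odd n then Neg (Mark x y letter u)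
      else Mark x y letter u) (Alt x y letter n u)) <->
    (if odd n then ~ marked v (g (var x y u)) else marked v (g (var x y u))) /\
    alternates n v (g (var x y u)).
  rewrite truth_conj IHn; case: (odd n); last by rewrite truth_mark.
  by rewrite -truth_mark.
by split=> -[v wv /E]; exists v.
Qed.

Lemma alternates_down n w v d : lte w v -> alternates n v d -> alternates n w d.
Proof.
case: n => // n wv [v' vv' H]; exists v' => //; exact: lte_trans wv vv'.
Qed.

Lemma alternates_pred n w d : alternates n.+1 w d -> alternates n w d.
Proof. by case=> v wv [_ H]; apply: alternates_down wv H. Qed.

Lemma alternates_le n m w d : n <= m -> alternates m w d -> alternates n w d.
Proof.
elim: m => [|m IHm]; first by case: n.
by rewrite leq_eqVlt => /predU1P[->|/IHm H] // /alternates_pred.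
Qed.

Definition has_length w l d : Prop := alternates l w d /\ ~ alternates l.+1 w d.

Lemma truth_length l w g u :
  truth w g (Length x y letter l u) <-> has_length w l (g (var x y u)).
Proof. by rewrite truth_conj truth_alt /has_length -(truth_alt l.+1). Qed.

Lemma has_length_uniq w l l' d : has_length w l d -> has_length w l' d -> l = l'.
Proof.
move=> [H1 H2] [H1' H2']; case: (ltngtP l l') => // ll'.
  by case: H2; apply: alternates_le H1'.
by case: H2'; apply: alternates_le H1.
Qed.

Lemma has_length_exists w n d :
  ~ alternates n w d -> exists2 l, l < n & has_length w l d.
Proof.
elim: n => [[]|n IHn H] //.
case: (classic (alternates n w d)) => [Hn|/IHn[l ln Hl]]; first by exists n.
by exists l; rewrite // ltnS ltnW.
Qed.

Variables (k : nat) (w0 : W).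

Definition register_le (i : nat) d (j : nat) d' : Prop :=
  forall l l', l < rank_tag_bound k -> l' < rank_tag_bound k ->
    has_length w0 l d -> has_length w0 l' d' ->
    forall w, lte w0 w ->
      alternates (rank_tag k l i).+1 w d -> alternates (rank_tag k l' j).+1 w d'.

(** Quantifiers never stand under a [Box] in a translation, so all of them range over the domain of
    the single world [w0]. *)
Lemma truth_translate p g (e : bool -> carrier M) :
  (forall u, e u = g (var x y u)) ->
  truth w0 g (translate x y letter k p) <-> fsat (dom w0) register_le e p.
Proof.
elim: p g e => [i u j v||p IHp q IHq|u p IHp] g e He.
- rewrite [translate _ _ _ _ _]/= [fsat _ _ _ _]/= !He; split=> H.
    move=> l l' lT l'T Hl Hl' w w0w.
    move/truth_conjN/(_ l lT)/truth_conjN/(_ l' l'T): H => /truth_imp H.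
    move/truth_length/H/truth_imp: Hl; move/truth_length: Hl' => Hl' /(_ Hl').
    by move/truth_always/(_ w w0w)/truth_imp; rewrite !truth_alt.
  apply/truth_conjN => l lT; apply/truth_conjN => l' l'T.
  apply/truth_imp => /truth_length Hl; apply/truth_imp => /truth_length Hl'.
  apply/truth_always => w w0w; apply/truth_imp; rewrite !truth_alt.
  exact: H w0w.
- by [].
- by rewrite /= (IHp g e He) (IHq g e He).
- split=> [H d dmd|H g' Hg' dmg'].
    pose g' z := if z == var x y u then d else g z.
    apply/(IHp g'); last apply: H.
    + move=> v; rewrite /update /g' He; case: eqP => [->|uv]; first by rewrite eqxx.
      case: eqP => // E; case: uv; move: E; rewrite /var.
      by case: (u) (v) => [] [] // E; case: x_neq_y.
    + by move=> z; rewrite /g'; case: eqP.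
    + by rewrite /g' eqxx.
  apply/(IHp g' (update e u (g' (var x y u)))); last exact: H.
  move=> v; rewrite /update; case: eqP => [->|uv] //.
  rewrite He Hg' // => E; case: uv; move: E; rewrite /var.
  by case: (u) (v) => [] [] // E; case: x_neq_y.
Qed.

(** The premise [lte w0 w] puts every world that is not at or above [w0] into all segments. They
    become initial in the whole order, and inclusions between them still depend only on the worlds
    from [w0] on. *)
Definition register_segment (i : nat) d w : Prop :=
  lte w0 w -> exists2 l, l < rank_tag_bound k & has_length w0 l d /\
    alternates (rank_tag k l i).+1 w d.

Lemma register_leP i j d d' :
  ~ alternates (rank_tag_bound k) w0 d -> ~ alternates (rank_tag_bound k) w0 d' ->
  register_le i d j d' <-> seg_le register_segment i d j d'.
Proof.
move=> /has_length_exists[l lT Hl] /has_length_exists[l' lT' Hl'].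
split=> [H w Hw w0w|H l1 l1' _ _ Hl1 Hl1' w w0w Hw].
  have [l1 _ [Hl1 alt]] := Hw w0w.
  by exists l' => //; split=> //; apply: H alt => //; rewrite (has_length_uniq Hl1 Hl).
have [|l2 _ [Hl2]] := H w _ w0w.
  by move=> _; exists l => //; rewrite (has_length_uniq Hl Hl1).
by rewrite (has_length_uniq Hl1' Hl2).
Qed.

Lemma register_segment_down i d u v :
  lt u v -> register_segment i d v -> register_segment i d u.
Proof.
move=> uv H w0u; have [|l lT [Hl alt]] := H; first by apply: lte_trans w0u _; left.
by exists l => //; split=> //; apply: alternates_down alt; left.
Qed.

(** The domain of [w0] carries records whose registers are initial segments of a well-order, so
    [standard] turns them into numbers. *)
Lemma normal_structure_of_truth p g :
  2 < k -> registers p <= k ->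
  truth w0 g (modal_sentence x y letter k (FAnd (standard k) p)) ->
  exists f e, normal_structure f /\ fsat (fun=> True) (nat_le f) e p.
Proof.
move=> k2 pk H; have [d0 dm0] := dom_nonempty M w0.
pose g' d z := if z == x then d else if z == y then d0 else g z.
have Hg d : dom w0 d -> ~ alternates (rank_tag_bound k) w0 d /\
    fsat (dom w0) register_le (fun u => if u then d0 else d) (FAnd (standard k) p).
  move=> dmd; have /truth_conj[Halt] :
      truth w0 (g' d) (Conj (Neg (Alt x y letter (rank_tag_bound k) false))
        (translate x y letter k (FAnd (standard k) p))).
    apply: (H (fun z => if z == x then d else g z)); rewrite ?eqxx //.
    + by move=> z /eqP/negbTE ->.
    + by move=> z /eqP/negbTE Hz; rewrite /g' Hz.
    + by rewrite /g' eqxx; case: eqP => // E; case: x_neq_y.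
  move/truth_translate => Hp; split.
    move=> Hd; apply: Halt; apply/truth_alt; rewrite /g' /= eqxx //.
  apply: Hp => -[]; rewrite /g' /= eqxx //; case: eqP => // E; case: x_neq_y => //.
have bounded d : dom w0 d -> ~ alternates (rank_tag_bound k) w0 d by case/Hg.
have [_ Hsat] := Hg d0 dm0.
set e : bool -> carrier M := fun u => _ in Hsat.
have dme u : dom w0 (e u) by rewrite /e; case: u.
have sp : registers (FAnd (standard k) p) <= k.
  by rewrite registers_and geq_max registers_standard.
have reg_seg : fsat (dom w0) register_le e (FAnd (standard k) p) <->
    fsat (dom w0) (seg_le register_segment) e (FAnd (standard k) p).
  apply: (@fsat_transfer _ _ (dom w0) (dom w0) _ _ id k) => //.
    by move=> a; exists a.
  by move=> i j d d' _ _ /bounded Hd /bounded Hd'; apply: register_leP.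
move/reg_seg: Hsat.
case/fsat_and => Hstd Hp.
have [f [N [nf surjN leN]]] := normal_structure_of_standard lt_wf lt_total
  (ex_intro _ d0 dm0) register_segment_down k2 Hstd.
exists f, (fun u => N (e u)); split=> //.
have num : fsat (dom w0) (seg_le register_segment) e p <->
    fsat (fun=> True) (nat_le f) (fun u => N (e u)) p.
  by apply: (@fsat_transfer _ _ (dom w0) (fun=> True) _ _ N k) => // a _; apply: surjN.
exact/num.
Qed.

End Truth.

(** * A model with constant domain realizing prescribed registers *)

Section TraceModel.
Variables (num : nat -> W) (pos : W -> option nat).
Hypothesis pos_num : pcancel num pos.
Hypothesis num_pos : forall w s, pos w = Some s -> w = num s.
Hypothesis num_lt : forall s t, s < t -> lt (num s) (num t).
Hypothesis pos_lt : forall v w t, lt v w -> pos w = Some t ->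
  exists2 s, pos v = Some s & s < t.
Variable trace : nat -> seq nat.
Hypothesis trace_sorted : forall c, sorted gtn (trace c).

(** A trace lists the positions in the copy of omega at which the marking of [c] changes; those
    still ahead are counted, and none is ahead outside the copy. *)
Definition remaining (w : W) (c : nat) : nat :=
  if pos w is Some s then count (ltn s) (trace c) else 0.

Lemma remaining_anti v w c : lte v w -> remaining w c <= remaining v c.
Proof.
rewrite /remaining => -[vw|-> //]; case E: (pos w) => [t|] //.
have [s -> st] := pos_lt vw E; apply: sub_count => a /=; lia.
Qed.

Lemma remaining_step w c n : n < remaining w c ->
  exists2 v, lte w v & remaining v c = n.+1.
Proof.
rewrite {1}/remaining; case E: (pos w) => [s|] //.
rewrite count_ltn_sorted // => Hn; pose t := nth 0 (trace c) n.+1.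
(* At position [t], the entry of index [n.+1] or the default 0, exactly the [n.+1] earlier entries
   lie ahead. The maximum avoids going below [w]. *)
exists (num (maxn s t)).
  rewrite (num_pos E) /lte; case: (ltngtP s t) => [st|ts|st].
  - by left; apply: num_lt.
  - by right.
  - by right; rewrite st.
have tn : t < nth 0 (trace c) n.
  case: (ltnP n.+1 (size (trace c))) => [nt|/(nth_default 0)]; last by rewrite /t => ->; lia.
  have gtn_trans : transitive gtn by move=> ? ? ?; lia.
  by apply: (sorted_ltn_nth gtn_trans 0 (trace_sorted c)) => //; rewrite inE // ltnW.
apply/eqP; rewrite /remaining pos_num eqn_leq leqNgt !count_ltn_sorted //.
rewrite /t in tn *; lia.
Qed.

Definition trace_frame : frame R :=
  @Frame W R nat (fun _ _ => True) (fun _ => ex_intro _ 0 I) (fun _ _ _ _ _ => I).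

Definition trace_model : model R :=
  @Model W R trace_frame (fun w n i t => odd (remaining w (head 0 t)))
    (fun _ _ _ _ _ _ => I).

(** The parity demanded at [v] excludes a count of exactly [n], so at least [n.+1] entries remain
    there. Conversely, [remaining_step] reaches a world with exactly the right count. *)
Lemma alternates_trace n w c :
  alternates (M := trace_model) n w c <-> n <= remaining w c.
Proof.
elim: n w => [|n IHn] w; first by split.
rewrite /= /marked /=; split=> [[v wv [odd_v /IHn Hv]]|Hn].
  apply: leq_trans (remaining_anti c wv); rewrite ltn_neqAle Hv andbT.
  by apply/eqP => E; move: odd_v; rewrite -E; case: (odd n).
have [v wv Hv] := remaining_step Hn; exists v => //; split; last by apply/IHn; lia.
by rewrite Hv /=; case: (odd n).
Qed.

Variables (k : nat) (f : nat -> nat -> nat).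
Hypothesis trace_pos : forall c, all (ltn 0) (trace c).
Hypothesis trace_size : forall c, size (trace c) < rank_tag_bound k.
Hypothesis trace_nth : forall c i, i < k ->
  nth 0 (trace c) (rank_tag k (size (trace c)) i) = f i c + rank_tag_bound k.

Lemma remaining_zero c : remaining (num 0) c = size (trace c).
Proof. by rewrite /remaining pos_num; apply/eqP; rewrite -all_count. Qed.

Lemma has_length_trace l c :
  has_length (M := trace_model) (num 0) l c <-> l = size (trace c).
Proof. rewrite /has_length !alternates_trace remaining_zero; lia. Qed.

Lemma register_le_trace i j c c' : i < k -> j < k ->
  register_le (M := trace_model) k (num 0) i c j c' <-> nat_le f i c j c'.
Proof.
move=> ik jk; rewrite /nat_le; split=> [H|fle l l' _ _ /has_length_trace-> /has_length_trace-> w _].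
  rewrite leqNgt; apply/negP => flt.
  have le0 t : lte (num 0) (num t) by case: (posnP t) => [->|]; [right|left; apply: num_lt].
  (* If the inequality failed, the world at position [f j c' + rank_tag_bound k] would lie in the
     first segment but not in the second. *)
  have := H _ _ (trace_size c) (trace_size c') (proj2 (has_length_trace _ _) erefl)
    (proj2 (has_length_trace _ _) erefl) _ (le0 (f j c' + rank_tag_bound k)).
  rewrite !alternates_trace /remaining pos_num !count_ltn_sorted // !trace_nth //.
  by rewrite ltnn ltn_add2r => /(_ flt).
rewrite !alternates_trace /remaining; case: (pos w) => // s.
rewrite !count_ltn_sorted // !trace_nth //; lia.
Qed.

Lemma satisfiable_of_trace p : registers p <= k ->
  (forall e', fsat (fun=> True) (nat_le f) e' p) ->
  satisfiable R (modal_sentence x y letter k p).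
Proof.
move=> pk Hp.
suff Hg g2 : truth (M := trace_model) (num 0) g2
    (Conj (Neg (Alt x y letter (rank_tag_bound k) false)) (translate x y letter k p)).
  by move/(_ trace_model (num 0) (fun=> 0)); apply=> [//|g1 _ _ g2 _ _]; apply: Hg.
apply/truth_conj; split.
  move/truth_alt/alternates_trace; rewrite remaining_zero; have := trace_size (g2 x).
  rewrite /var; lia.
apply/(truth_translate k (num 0) p (e := fun u => g2 (var x y u))) => //.
have E : fsat (dom (num 0)) (register_le (M := trace_model) k (num 0))
    (fun u => g2 (var x y u)) p <->
  fsat (fun=> True) (nat_le f) (fun u => g2 (var x y u)) p.
  apply: (@fsat_transfer _ _ _ _ _ _ id k) => //; first by move=> a _; exists a.
  by move=> i j d d' ik jk _ _; apply: register_le_trace.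
exact/E.
Qed.

End TraceModel.

(** Tagged sequences of the register values serve as traces, in any order of worlds beginning with a
    copy of omega. *)
Lemma satisfiable_of_normal_structure (num : nat -> W) (pos : W -> option nat) k f p :
  pcancel num pos -> (forall w s, pos w = Some s -> w = num s) ->
  (forall s t, s < t -> lt (num s) (num t)) ->
  (forall v w t, lt v w -> pos w = Some t -> exists2 s, pos v = Some s & s < t) ->
  normal_structure f -> registers p <= k -> 2 < k ->
  (forall e, fsat (fun=> True) (nat_le f) e p) ->
  satisfiable R (modal_sentence x y letter k (FAnd (standard k) p)).
Proof.
move=> posK num_pos num_lt pos_lt nf pk k2 Hp.
have H c := tagged_sequence k (f^~ c).
pose trace c := proj1_sig (constructive_indefinite_description _ (H c)).
have Htrace c : [/\ sorted gtn (trace c), all (ltn 0) (trace c),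
    size (trace c) < rank_tag_bound k & forall i, i < k ->
    nth 0 (trace c) (rank_tag k (size (trace c)) i) = f i c + rank_tag_bound k].
  by rewrite /trace; case: constructive_indefinite_description.
apply: (@satisfiable_of_trace num pos posK num_pos num_lt pos_lt trace _ k f) => //.
all: try by move=> c; case: (Htrace c).
- by rewrite registers_and geq_max registers_standard.
- by move=> e; apply/fsat_and; split=> //; apply: standard_normal.
Qed.

End Semantics.

(** * The ordinals *)

Section Ordinals.
Variables m k : nat.
Implicit Types u v w : ordinal_wmk m k.

Lemma ordinal_ltE u v : ordinal_lt u v <->
  match u, v with
  | inl (a, s), inl (b, t) => (a < b) || (a == b) && (s < t)
  | inl _, inr _ => true
  | inr _, inl _ => false
  | inr c, inr d => c < d
  end.
Proof.
split=> [|].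
  by case=> [p q [a b s t ab|a s t st]|[a s] q|c d cd] //; rewrite ?ab ?st ?eqxx ?orbT.
case: u v => [[a s]|c] [[b t]|d] // H; constructor => //.
by case/orP: H => [ab|/andP[/eqP-> st]]; constructor.
Qed.

Lemma ordinal_lt_trans u v w : ordinal_lt u v -> ordinal_lt v w -> ordinal_lt u w.
Proof.
rewrite !ordinal_ltE; case: u v w => [[a s]|c] [[b t]|d] [[a' s']|c'] //=.
  by rewrite -!val_eqE /=; lia.
exact: ltn_trans.
Qed.

Lemma ordinal_lt_total u v : [\/ ordinal_lt u v, u = v | ordinal_lt v u].
Proof.
case: u v => [[a s]|c] [[b t]|d].
- case: (ltngtP a b) => [ab|ba|/val_inj->].
  + by constructor 1; rewrite ordinal_ltE ab.
  + by constructor 3; rewrite ordinal_ltE ba.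
  + case: (ltngtP s t) => [st|ts|->]; last by constructor.
      by constructor 1; rewrite ordinal_ltE eqxx st orbT.
    by constructor 3; rewrite ordinal_ltE eqxx ts orbT.
- by constructor 1; apply/ordinal_ltE.
- by constructor 3; apply/ordinal_ltE.
- case: (ltngtP c d) => [cd|dc|/val_inj->]; last by constructor.
    by constructor 1; apply/ordinal_ltE.
  by constructor 3; apply/ordinal_ltE.
Qed.

Lemma ordinal_lt_wf : well_founded (@ordinal_lt m k).
Proof.
have wf_nat : well_founded (fun a b : nat => a < b).
  by elim/ltn_ind => a IHa; constructor=> b /IHa.
have wf_ord n : well_founded (fun a b : 'I_n => a < b).
  exact: wf_inverse_image wf_nat.
apply: wf_disjoint_sum (wf_ord k).
exact: wf_slexprod (wf_ord m) wf_nat.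
Qed.

Hypothesis m_pos : 1 <= m.

Definition finite_ordinal (s : nat) : ordinal_wmk m k := inl (Ordinal m_pos, s).

Definition finite_position (w : ordinal_wmk m k) : option nat :=
  if w is inl (a, s) then if val a == 0 then Some s else None else None.

Lemma finite_ordinalK : pcancel finite_ordinal finite_position.
Proof. by []. Qed.

Lemma finite_positionK w s : finite_position w = Some s -> w = finite_ordinal s.
Proof.
case: w => [[a t]|//] /=; case: eqP => // a0 [->].
by congr (inl (_, _)); apply: val_inj.
Qed.

Lemma finite_ordinal_lt s t : s < t -> ordinal_lt (finite_ordinal s) (finite_ordinal t).
Proof. by move=> st; apply/ordinal_ltE; rewrite /= st. Qed.

Lemma finite_ordinal_initial v w t : ordinal_lt v w -> finite_position w = Some t ->
  exists2 s, finite_position v = Some s & s < t.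
Proof.
move=> vw /finite_positionK E; move: vw; rewrite {w}E => /ordinal_ltE; case: v => [[a s]|//].
move=> /= /andP[/eqP a0 st].
by exists s; rewrite // a0.
Qed.

End Ordinals.

(** * Arithmetic in two-variable logic *)

Notation nsat f e p := (fsat (fun=> True) (nat_le f) e p).

(* Registers 3 and 4 are the components of a number read as a pair in Cantor's
   enumeration, 5 and 9 their sum and product, 6, 7 and 8 the successors of 3,
   4 and 5, and 10 is the sum of 9 and 4.  The others hold the values of terms,
   in the environment listed by iterated pairing, and the set variables, a
   number being a member when its register is 0. *)
Fixpoint term_code (t : aterm) : nat :=
  match t with
  | TVar n => pair_code 0 n
  | TZero => pair_code 1 0
  | TSucc s => pair_code 2 (term_code s)
  | TAdd s t => pair_code 3 (pair_code (term_code s) (term_code t))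
  | TMul s t => pair_code 4 (pair_code (term_code s) (term_code t))
  end.

Lemma term_code_inj : injective term_code.
Proof.
elim=> [n||s IHs|s IHs t IHt|s IHs t IHt] [n'||s'|s' t'|s' t'] /= /pair_code_inj[] //.
- by move=> _ ->.
- by move=> _ /IHs->.
- by move=> _ /pair_code_inj[/IHs-> /IHt->].
- by move=> _ /pair_code_inj[/IHs-> /IHt->].
Qed.

(** The first component of the pair keeps set registers apart from term registers, and 11 skips the
    fixed ones. *)
Definition set_register (i : nat) : nat := 11 + pair_code 0 i.
Definition term_register (t : aterm) : nat := 11 + pair_code 1 (term_code t).

Definition FComp (g h l : nat) : fo2 :=
  FAll false (FEx true (FAnd (FEq 0 true l false) (FEq h true g false))).

(** The witness is the pair of the two arguments, and its register [o] is the result of the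
    operation. *)
Definition FOp (g o h l : nat) : fo2 :=
  FAll false (FEx true (FAnd (FEq 3 true h false)
    (FAnd (FEq 4 true l false) (FEq o true g false)))).

(** Cantor's enumeration goes from [(0, b)] to [(b.+1, 0)] and from [(a.+1, b)] to [(a, b.+1)]; the
    sum grows only in the first case. *)
Definition pair_step : fo2 :=
  FAll false (FAll true (FImp (FEq 1 false 0 true) (FAnd
    (FImp (FEq 3 false 2 false)
       (FAnd (FEq 3 true 7 false) (FAnd (FEq 4 true 2 true) (FEq 5 true 8 false))))
    (FImp (FNot (FEq 3 false 2 false))
       (FAnd (FEq 6 true 3 false) (FAnd (FEq 4 true 7 false) (FEq 5 true 5 false))))))).

(** Products are defined by recursion on the first component, with register 10 giving the next
    value. Surjectivity of pairing will follow by induction. *)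
Definition arithmetic_axioms : fo2 :=
  FAnd (FComp 6 1 3) (FAnd (FComp 7 1 4) (FAnd (FComp 8 1 5)
 (FAnd (FAll false (FImp (FEq 0 false 2 false)
          (FAnd (FEq 3 false 2 false) (FAnd (FEq 4 false 2 false) (FEq 5 false 2 false)))))
 (FAnd pair_step
 (FAnd (FAll false (FImp (FEq 3 false 2 false) (FEq 9 false 2 false)))
 (FAnd (FAll false (FAll true (FImp (FAnd (FEq 6 true 3 false) (FEq 4 true 4 false))
          (FEq 9 false 10 true))))
       (FOp 10 5 9 4))))))).

Definition var_axiom (n : nat) : fo2 :=
  if n is n'.+1 then FComp (term_register (TVar n)) (term_register (TVar n')) 4
  else FAll false (FEq (term_register (TVar 0)) false 3 false).

Fixpoint term_axioms (t : aterm) : fo2 :=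
  match t with
  | TVar n => FAndN n.+1 var_axiom
  | TZero => FAll false (FEq (term_register TZero) false 2 false)
  | TSucc s =>
      FAnd (FComp (term_register (TSucc s)) 1 (term_register s)) (term_axioms s)
  | TAdd s t =>
      FAnd (FOp (term_register (TAdd s t)) 5 (term_register s) (term_register t))
           (FAnd (term_axioms s) (term_axioms t))
  | TMul s t =>
      FAnd (FOp (term_register (TMul s t)) 9 (term_register s) (term_register t))
           (FAnd (term_axioms s) (term_axioms t))
  end.

Fixpoint formula_axioms (a : aform) : fo2 :=
  match a with
  | AEq s t => FAnd (term_axioms s) (term_axioms t)
  | AMem s _ => term_axioms s
  | ABot => FNot FBot
  | AImp a b => FAnd (formula_axioms a) (formula_axioms b)
  | AAll a => formula_axioms a
  end.

(** The variable [u] carries the environment. A quantifier extends it into the other variable, a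
    record with tail [u], after which [u] can be reused; so two variables suffice at any depth. *)
Fixpoint holds (u : bool) (a : aform) : fo2 :=
  match a with
  | AEq s t => FEq (term_register s) u (term_register t) u
  | AMem s i => FAll (~~ u) (FImp (FEq 0 (~~ u) (term_register s) u)
                              (FEq (set_register i) (~~ u) 2 (~~ u)))
  | ABot => FBot
  | AImp a b => FImp (holds u a) (holds u b)
  | AAll a => FAll (~~ u) (FImp (FEq 4 (~~ u) 0 u) (holds (~~ u) a))
  end.

Definition numeral_zero : fo2 := FEq 0 false 2 false.
(** The predecessor is found in the other variable and copied back, so that the same context can be
    iterated. *)
Definition numeral_succ (p : fo2) : fo2 :=
  FEx true (FAnd (FEq 1 true 0 false) (FEx false (FAnd (FEq 0 false 0 true) p))).
Definition numeral (n : nat) : fo2 := iter n numeral_succ numeral_zero.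

Definition holds_at (a : aform) (n : nat) : fo2 :=
  FEx true (FAnd (FEq 4 true 2 true) (FAnd (holds true a)
    (FEx false (FAnd (FEq 0 false 3 true) (numeral n))))).

Definition sigma11_axioms (a : aform) (n : nat) : fo2 :=
  FAnd (FAnd arithmetic_axioms (formula_axioms a)) (holds_at a n).

(** An environment coded by a number is an infinite sequence, hence a function instead of a list. *)
Fixpoint teval (rho : nat -> nat) (t : aterm) : nat :=
  match t with
  | TVar n => rho n
  | TZero => 0
  | TSucc s => (teval rho s).+1
  | TAdd s t => teval rho s + teval rho t
  | TMul s t => teval rho s * teval rho t
  end.

Lemma aeval_teval s rho t : (forall n, rho n = nth 0 s n) -> aeval s t = teval rho t.
Proof. by move=> H; elim: t => //= [s1 ->|s1 -> t ->|s1 -> t ->]. Qed.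

Definition environment (f : nat -> nat -> nat) (c n : nat) : nat :=
  f 3 (iter n (f 4) c).

Lemma nat_le_eq f i a j b : nat_le f i a j b /\ nat_le f j b i a <-> f i a = f j b.
Proof. by rewrite /nat_le; split=> [[]|->]; lia. Qed.

(** * Correctness of the axioms in a structure on the natural numbers *)

Section NatStructure.
Variable f : nat -> nat -> nat.
Hypothesis nf : normal_structure f.

Lemma register0 c : f 0 c = c. Proof. by case: (nf c). Qed.
Lemma register1 c : f 1 c = c.+1. Proof. by case: (nf c). Qed.
Lemma register2 c : f 2 c = 0. Proof. by case: (nf c). Qed.

Lemma nsat_comp e g h l : nsat f e (FComp g h l) <-> forall c, f g c = f h (f l c).
Proof.
split=> [/fsat_all H c|H].
  have /fsat_ex[d [_ /fsat_and[/fsat_nat_eq + /fsat_nat_eq]]] := H c I.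
  by rewrite /update /= register0 => <-.
apply/fsat_all => c _; apply/fsat_ex; exists (f l c); split=> //.
by apply/fsat_and; split; apply/fsat_nat_eq; rewrite /update /= ?register0 ?H.
Qed.

Lemma nsat_op e g o h l : nsat f e (FOp g o h l) <->
  forall c, exists d, [/\ f 3 d = f h c, f 4 d = f l c & f o d = f g c].
Proof.
split=> [/fsat_all H c|H].
  have /fsat_ex[d [_ /fsat_and[/fsat_nat_eq H1]]] := H c I.
  by move=> /fsat_and[/fsat_nat_eq H2 /fsat_nat_eq H3]; exists d.
apply/fsat_all => c _; have [d [H1 H2 H3]] := H c.
apply/fsat_ex; exists d; split=> //.
by apply/fsat_and; split; [|apply/fsat_and; split]; apply/fsat_nat_eq.
Qed.

Lemma nsat_numeral e n : nsat f e (numeral n) <-> e false = n.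
Proof.
elim: n e => [|n IHn] e; first by rewrite fsat_nat_eq register0 register2.
split=> [/fsat_ex[c [_ /fsat_and[/fsat_nat_eq + /fsat_ex[d [_]]]]]|He].
  move=> + /fsat_and[/fsat_nat_eq + /IHn].
  by rewrite /update /= !register0 register1 => <- <- ->.
apply/fsat_ex; exists n; split=> //; apply/fsat_and; split.
  by apply/fsat_nat_eq; rewrite /update /= register0 register1.
apply/fsat_ex; exists n; split=> //; apply/fsat_and; split; last exact/IHn.
by apply/fsat_nat_eq; rewrite /update.
Qed.

Record arithmetic : Prop := {
  pair_surjective : forall a b, exists2 c, f 3 c = a & f 4 c = b;
  pair_zero : f 3 0 = 0 /\ f 4 0 = 0;
  pair_sum : forall c, f 5 c = f 3 c + f 4 c;
  pair_product : forall c, f 9 c = f 3 c * f 4 c }.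

Lemma arithmetic_of_axioms e : nsat f e arithmetic_axioms -> arithmetic.
Proof.
case/fsat_and=> /nsat_comp f6 /fsat_and[/nsat_comp f7] /fsat_and[/nsat_comp f8].
case/fsat_and=> /fsat_all zero /fsat_and[/fsat_all step].
case/fsat_and=> /fsat_all mul0 /fsat_and[/fsat_all mulS] /nsat_op f10.
have [A0 B0 C0] : [/\ f 3 0 = 0, f 4 0 = 0 & f 5 0 = 0].
  have /fsat_imp := zero 0 I.
  rewrite !fsat_and /= !nat_le_eq /update /= register0 !register2.
  by move=> /(_ erefl)[? []].
have {}step c : (f 3 c = 0 -> [/\ f 3 c.+1 = (f 4 c).+1, f 4 c.+1 = 0 & f 5 c.+1 = (f 5 c).+1])
    /\ (f 3 c <> 0 -> [/\ (f 3 c.+1).+1 = f 3 c, f 4 c.+1 = (f 4 c).+1 & f 5 c.+1 = f 5 c]).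
  have /fsat_all/(_ c.+1 I)/fsat_imp H := step c I.
  have /H/fsat_and[/fsat_imp + /fsat_imp] :
      nsat f (update (update e false c) true c.+1) (FEq 1 false 0 true).
    by apply/fsat_nat_eq; rewrite /update /= register0 register1.
  rewrite fsat_not !fsat_and /= !nat_le_eq /update /= !register2 f6 f7 f8 !register1.
  by move=> H1 H2; split=> [/H1|/H2] [? []].
(* Induction on the diagonal [a + b], then along it: its first point [(s.+1, 0)] comes right after
   [(0, s)], the end of the previous diagonal. *)
have surj a b : exists2 c, f 3 c = a & f 4 c = b.
  have [s] : {s | s = a + b} by exists (a + b).
  elim: s a b => [|s IHs] a b Hs.
    by exists 0; rewrite ?A0 ?B0; lia.
  elim: b a Hs => [|b IHb] a Hs.
    have [c Hc Hc'] := IHs 0 s erefl; have [/(_ Hc)[H1 H2 _] _] := step c.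
    by exists c.+1; lia.
  have [|c Hc Hc'] := IHb a.+1; first lia.
  have [_ [|H1 H2 _]] := step c; first by rewrite Hc.
  by exists c.+1; lia.
have sum c : f 5 c = f 3 c + f 4 c.
  elim: c => [|c IHc]; first by rewrite A0 B0 C0.
  have [H1 H2] := step c.
  by case: (f 3 c =P 0) => [/[dup] ? /H1[]|/[dup] ? /H2[]]; lia.
split=> // c.
(* Induction on the first component; [surj] supplies the record with the same second component and
   the preceding first one. *)
have [a] : {a | f 3 c = a} by exists (f 3 c).
elim: a c => [|a IHa] c Hc.
  have /fsat_imp := mul0 c I.
  by rewrite !fsat_nat_eq /update /= Hc !register2 mul0n; apply.
have [d Hd Hd'] := surj a (f 4 c).
have /fsat_all/(_ d I)/fsat_imp := mulS c I.
rewrite !fsat_and /= !nat_le_eq /update /= f6 register1 Hd Hd' Hc => /(_ (conj erefl erefl)) ->.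
have [d' [H1 H2 <-]] := f10 d.
by rewrite sum H1 H2 IHa // Hd Hd' mulSn addnC.
Qed.

Hypothesis arith : arithmetic.

Lemma nsat_op_sum e g h l :
  nsat f e (FOp g 5 h l) <-> forall c, f g c = f h c + f l c.
Proof.
rewrite nsat_op; split=> [H c|H c].
  by have [d [<- <- <-]] := H c; apply: pair_sum.
have [d H1 H2] := pair_surjective arith (f h c) (f l c).
by exists d; rewrite H pair_sum // H1 H2.
Qed.

Lemma nsat_op_product e g h l :
  nsat f e (FOp g 9 h l) <-> forall c, f g c = f h c * f l c.
Proof.
rewrite nsat_op; split=> [H c|H c].
  by have [d [<- <- <-]] := H c; apply: pair_product.
have [d H1 H2] := pair_surjective arith (f h c) (f l c).
by exists d; rewrite H pair_product // H1 H2.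
Qed.

Lemma nsat_all_eq e i j :
  nsat f e (FAll false (FEq i false j false)) <-> forall c, f i c = f j c.
Proof.
rewrite fsat_all; split=> H c; first by have /fsat_nat_eq := H c I.
by move=> _; apply/fsat_nat_eq; rewrite H.
Qed.

Lemma nsat_term_axioms e t :
  (forall t c, f (term_register t) c = teval (environment f c) t) ->
  nsat f e (term_axioms t).
Proof.
move=> H; elim: t => [n||s IHs|s IHs t IHt|s IHs t IHt].
- apply/fsat_andN => -[_|i _]; first by apply/nsat_all_eq => c; rewrite H.
  by apply/nsat_comp => c; rewrite !H /= /environment iterSr.
- by apply/nsat_all_eq => c; rewrite H register2.
- by apply/fsat_and; split=> //; apply/nsat_comp => c; rewrite !H register1.
- by apply/fsat_and; split; [apply/nsat_op_sum => c; rewrite !H|apply/fsat_and].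
- by apply/fsat_and; split; [apply/nsat_op_product => c; rewrite !H|apply/fsat_and].
Qed.

Lemma term_value e t : nsat f e (term_axioms t) ->
  forall c, f (term_register t) c = teval (environment f c) t.
Proof.
elim: t => [n||s IHs|s IHs t IHt|s IHs t IHt].
- move=> /fsat_andN H; elim: n H => [|n IHn] H c.
    by have /nsat_all_eq-> := H 0 isT.
  have /nsat_comp-> := H n.+1 (ltnSn _).
  by rewrite IHn => [|i Hi]; [rewrite /= /environment iterSr|apply: H; rewrite ltnW].
- by move/nsat_all_eq => H c; rewrite H register2.
- by case/fsat_and=> /nsat_comp H /IHs Hs c; rewrite H register1 Hs.
- by case/fsat_and=> /nsat_op_sum H /fsat_and[/IHs Hs /IHt Ht] c; rewrite H Hs Ht.
- by case/fsat_and=> /nsat_op_product H /fsat_and[/IHs Hs /IHt Ht] c; rewrite H Hs Ht.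
Qed.

(** Surjectivity of pairing gives a record for every extension of an environment by a number, so
    quantifiers over records and over numbers agree. *)
Lemma nsat_holds e0 a : nsat f e0 (formula_axioms a) -> forall u e s,
  (forall n, environment f (e u) n = nth 0 s n) ->
  nsat f e (holds u a) <-> asat (fun i c => f (set_register i) c = 0) s a.
Proof.
have neg_u u : (u == ~~ u) = false by case: u.
elim: a => [s t|s i||a IHa b IHb|a IHa] Hax u e env He; rewrite [holds _ _]/= [asat _ _ _]/=.
- case/fsat_and: Hax => /term_value Hs /term_value Ht.
  by rewrite fsat_nat_eq Hs Ht !(aeval_teval _ He).
- rewrite (aeval_teval _ He) -(term_value Hax); split=> [/fsat_all H|H].
    have /fsat_imp := H (f (term_register s) (e u)) I.
    by rewrite !fsat_nat_eq /update eqxx neg_u register0 register2; apply.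
  apply/fsat_all => c _; apply/fsat_imp.
  by rewrite !fsat_nat_eq /update eqxx neg_u register0 register2 => ->.
- by [].
- case/fsat_and: Hax => Ha Hb.
  by rewrite fsat_imp (IHa Ha u e env He) (IHb Hb u e env He).
- have env_cons c d : f 4 c = e u -> f 3 c = d ->
      forall n, environment f (update e (~~ u) c (~~ u)) n = nth 0 (d :: env) n.
    move=> Hc Hd [|n]; rewrite /environment /update eqxx //.
    by rewrite iterSr Hc; apply: He.
  split=> [/fsat_all H d|H].
    have [c Hc Hc'] := pair_surjective arith d (e u).
    apply/(IHa Hax (~~ u) _ _ (env_cons c d Hc' Hc)).
    have /fsat_imp := H c I; apply.
    by apply/fsat_nat_eq; rewrite /update eqxx neg_u register0.
  apply/fsat_all => c _; apply/fsat_imp => /fsat_nat_eq.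
  rewrite /update eqxx neg_u register0 => Hc.
  by apply/(IHa Hax (~~ u) _ _ (env_cons c _ Hc erefl)).
Qed.

Lemma nsat_holds_at e0 e a n : nsat f e0 (formula_axioms a) ->
  nsat f e (holds_at a n) <-> asat (fun i c => f (set_register i) c = 0) [:: n] a.
Proof.
move=> Hax; have [A0 B0] := pair_zero arith.
(* Zero is its own tail and has head 0, so a record with tail 0 agrees with a one-element list
   followed by the default of [nth]. *)
have env c : f 4 c = 0 -> forall i, environment f c i = nth 0 [:: f 3 c] i.
  move=> Hc [|i] //=; rewrite nth_nil /environment iterSr Hc.
  by have -> : iter i (f 4) 0 = 0 by elim: i => //= i ->.
split=> [/fsat_ex[c [_ /fsat_and[/fsat_nat_eq + /fsat_and[Ha /fsat_ex[d [_]]]]]]|Ha].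
  move=> + /fsat_and[/fsat_nat_eq + /(nsat_numeral _ _)].
  rewrite /update /= register0 register2 => Hc -> Hn.
  by apply/(nsat_holds Hax _ (e := update e true c) (u := true)); [rewrite -Hn; exact: env|].
have [c Hc Hc'] := pair_surjective arith n 0.
apply/fsat_ex; exists c; split=> //; apply/fsat_and; split.
  by apply/fsat_nat_eq; rewrite /update /= register2.
apply/fsat_and; split.
  by apply/(nsat_holds Hax _ (s := [:: n])) => // i; rewrite -Hc; apply: env.
apply/fsat_ex; exists n; split=> //; apply/fsat_and; split; last exact/nsat_numeral.
by apply/fsat_nat_eq; rewrite /update /= register0.
Qed.

End NatStructure.

(** * The intended structure, with freely chosen sets *)

Section CantorStructure.
Variable X : nat -> nat -> Prop.

Definition fst_of (c : nat) : nat := (Cantor.of_nat c).1.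
Definition snd_of (c : nat) : nat := (Cantor.of_nat c).2.

Definition sequence_of (c n : nat) : nat := fst_of (iter n snd_of c).

(** Classical case analysis on whether the index codes a term replaces a decoder; any other index is
    read as that of a set variable. *)
Definition extra_register (i c : nat) : nat :=
  if excluded_middle_informative (exists t, i = pair_code 1 (term_code t)) is left H
  then teval (sequence_of c) (proj1_sig (constructive_indefinite_description _ H))
  else if excluded_middle_informative (X (snd_of i) c) then 0 else 1.

Definition cantor_structure (i c : nat) : nat :=
  match i with
  | 0 => c
  | 1 => c.+1
  | 2 => 0
  | 3 => fst_of c
  | 4 => snd_of c
  | 5 => fst_of c + snd_of c
  | 6 => (fst_of c).+1
  | 7 => (snd_of c).+1
  | 8 => (fst_of c + snd_of c).+1
  | 9 => fst_of c * snd_of c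
  | 10 => fst_of c * snd_of c + snd_of c
  | i'.+4.+4.+3 => extra_register i' c
  end.

Lemma cantor_normal : normal_structure cantor_structure.
Proof. by []. Qed.

(** [Cantor.of_nat] is itself a recursion along the enumeration, so one unfolding gives both
    cases. *)
Lemma fst_snd_succ c :
  (fst_of c = 0 -> fst_of c.+1 = (snd_of c).+1 /\ snd_of c.+1 = 0) /\
  (fst_of c <> 0 -> (fst_of c.+1).+1 = fst_of c /\ snd_of c.+1 = (snd_of c).+1).
Proof.
rewrite /fst_of /snd_of [Cantor.of_nat c.+1]/= -/(Cantor.of_nat c).
by case: (Cantor.of_nat c) => [[|a] b].
Qed.

Lemma fst_snd_surjective a b : exists2 c, fst_of c = a & snd_of c = b.
Proof.
by exists (Cantor.to_nat (a, b)); rewrite /fst_of /snd_of Cantor.cancel_of_to.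
Qed.

Lemma cantor_arithmetic : arithmetic cantor_structure.
Proof. by split=> //; apply: fst_snd_surjective. Qed.

Lemma cantor_arithmetic_axioms e : nsat cantor_structure e arithmetic_axioms.
Proof.
have nf := cantor_normal.
rewrite /arithmetic_axioms fsat_and nsat_comp //; split=> //.
rewrite fsat_and nsat_comp //; split=> //.
rewrite fsat_and nsat_comp //; split=> //.
apply/fsat_and; split.
  apply/fsat_all => c _; apply/fsat_imp.
  by rewrite !fsat_and /= !nat_le_eq /update /= => ->.
apply/fsat_and; split.
  apply/fsat_all => c _; apply/fsat_all => d _; apply/fsat_imp.
  move=> Hd; have {Hd}-> : d = c.+1 by move/fsat_nat_eq: Hd; rewrite /update /= => <-.
  have [H1 H2] := fst_snd_succ c; apply/fsat_and; split; apply/fsat_imp.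
    rewrite !fsat_and /= !nat_le_eq /update /= => /[dup] Hc /H1[-> ->]; rewrite Hc; lia.
  rewrite fsat_not !fsat_and /= !nat_le_eq /update /= => /H2[E ->]; lia.
apply/fsat_and; split.
  by apply/fsat_all => c _; apply/fsat_imp; rewrite !fsat_nat_eq /update /= => ->.
apply/fsat_and; split.
  apply/fsat_all => c _; apply/fsat_all => d _; apply/fsat_imp.
  by rewrite !fsat_and /= !nat_le_eq /update /= => -[<- ->]; rewrite mulSn addnC.
exact/(nsat_op_sum cantor_arithmetic).
Qed.

Lemma cantor_term_register t c :
  cantor_structure (term_register t) c = teval (environment cantor_structure c) t.
Proof.
rewrite /term_register /= /extra_register.
case: excluded_middle_informative => [H|[]]; last by exists t.
by case: constructive_indefinite_description => t' /= /pair_code_inj[_ /term_code_inj->].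
Qed.

Lemma cantor_set_register i c : cantor_structure (set_register i) c = 0 <-> X i c.
Proof.
rewrite /set_register /= /extra_register.
case: excluded_middle_informative => [[t /pair_code_inj[]]|_] //.
rewrite /snd_of /pair_code Cantor.cancel_of_to /=.
by case: excluded_middle_informative.
Qed.

Lemma cantor_formula_axioms e a : nsat cantor_structure e (formula_axioms a).
Proof.
elim: a => [s t|s i||a IHa b IHb|a IHa] //=.
- by apply/fsat_and; split; apply: (nsat_term_axioms cantor_normal cantor_arithmetic);
    apply: cantor_term_register.
- by apply: (nsat_term_axioms cantor_normal cantor_arithmetic); apply: cantor_term_register.
- by apply/fsat_and.
Qed.

End CantorStructure.

Lemma asat_ext X Y : (forall i c, X i c <-> Y i c) ->
  forall a e, asat X e a <-> asat Y e a.
Proof.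
move=> XY; elim=> [s t|s i||a IHa b IHb|a IHa] e //=; first by rewrite IHa IHb.
by split=> H n; apply/IHa.
Qed.

Lemma sigma11_structure X a n : asat X [:: n] a ->
  exists2 f, normal_structure f & forall e, nsat f e (sigma11_axioms a n).
Proof.
move=> HX; exists (cantor_structure X) => [|e]; first exact: cantor_normal.
have Hax := cantor_formula_axioms X e a.
apply/fsat_and; split.
  by apply/fsat_and; split=> //; apply: cantor_arithmetic_axioms.
apply/(nsat_holds_at (cantor_normal X) (cantor_arithmetic X) _ n Hax).
exact/(asat_ext (cantor_set_register X)).
Qed.

Lemma sigma11_of_structure f e a n :
  normal_structure f -> nsat f e (sigma11_axioms a n) -> exists X, asat X [:: n] a.
Proof.
move=> nf /fsat_and[/fsat_and[/(arithmetic_of_axioms nf) arith Hax] Ha].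
exists (fun i c => f (set_register i) c = 0).
exact/(nsat_holds_at nf arith e n Hax).
Qed.

(** Independent of [n], as numerals use only registers below 3; thus one translation serves the
    whole reduction. The constant 11 covers the arithmetical axioms. *)
Definition sigma11_registers (a : aform) : nat :=
  maxn 11 (maxn (registers (formula_axioms a)) (registers (holds true a))).

Lemma registers_numeral n : registers (numeral n) <= 3.
Proof.
elim: n => [|n IHn]; first by rewrite registers_eq.
rewrite /numeral iterS -/(numeral n) /numeral_succ.
by rewrite registers_ex registers_and registers_ex registers_and !registers_eq !geq_max IHn.
Qed.

Lemma registers_holds_at a n k : registers (holds true a) <= k -> 4 < k ->
  registers (holds_at a n) <= k.
Proof.
move: (registers_numeral n); rewrite /holds_at; move: (numeral n) (holds true a).
move=> p q Hp Hq k4; rewrite registers_ex registers_and registers_eq registers_and.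
rewrite registers_ex registers_and registers_eq !geq_max Hq k4 /= (leq_trans Hp) ?andbT;
  exact: ltn_trans k4.
Qed.

Lemma registers_sigma11_axioms a n : registers (sigma11_axioms a n) <= sigma11_registers a.
Proof.
set k := sigma11_registers a; have k11 : 11 <= k by rewrite leq_max.
rewrite /sigma11_axioms registers_and geq_max registers_holds_at ?andbT.
- rewrite registers_and geq_max [registers arithmetic_axioms <= k]k11.
  by rewrite !leq_max leqnn orbT.
- by rewrite !leq_max leqnn !orbT.
- exact: leq_trans k11.
Qed.

(** * Computability of the reduction *)

Section Contexts.
Variables x y letter k : nat.
Notation tr := (translate x y letter k).

Lemma computable_context_conj psi C : computable_context C ->
  computable_context (fun phi => Conj psi (C phi)).
Proof.
move=> HC; apply: computable_context_imp (computable_context_const _).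
apply: computable_context_imp (computable_context_const _) _.
exact: computable_context_imp HC (computable_context_const _).
Qed.

Lemma computable_context_ex u C : computable_context C ->
  computable_context (fun phi => Neg (All (var x y u) (Neg (C phi)))).
Proof.
move=> HC; apply: computable_context_imp (computable_context_const _).
by apply: computable_context_all; apply: computable_context_imp (computable_context_const _).
Qed.

Lemma recursive_sigma11_sentence a :
  recursive (fun t : 1.-tuple nat =>
    code (modal_sentence x y letter k (FAnd (standard k) (sigma11_axioms a (thead t))))).
Proof.
(* [D] is the translated form of [numeral_succ], and [C] below is the whole sentence around the
   numeral; both agree with the translation by computation. *)
pose D phi := Neg (All (var x y true) (Neg (Conj (tr (FEq 1 true 0 false))
  (Neg (All (var x y false) (Neg (Conj (tr (FEq 0 false 0 true)) phi))))))).
have HD : computable_context D.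
  apply: computable_context_ex; apply: computable_context_conj.
  by apply: computable_context_ex; apply: computable_context_conj; apply: computable_context_id.
pose p0 := FAnd arithmetic_axioms (formula_axioms a).
pose C phi := All x (All y (Conj (Neg (Alt x y letter (rank_tag_bound k) false))
  (Conj (tr (standard k)) (Conj (tr p0)
  (Neg (All (var x y true) (Neg (Conj (tr (FEq 4 true 2 true)) (Conj (tr (holds true a))
  (Neg (All (var x y false) (Neg (Conj (tr (FEq 0 false 3 true)) phi))))))))))))).
have HC : computable_context C.
  do 2!apply: computable_context_all.
  do 3!apply: computable_context_conj.
  apply: computable_context_ex; do 2!apply: computable_context_conj.
  by apply: computable_context_ex; apply: computable_context_conj; apply: computable_context_id.
apply: (rec_comp (f := fun t : 1.-tuple nat => code (C (iter (thead t) D (tr numeral_zero))))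
  (g := fun _ : 'I_1 => fun t => thead t)) => [|l|t].
- exact: recursive_code_iter.
- exact: (@rec_proj _ ord0).
have trE n : tr (numeral n) = iter n D (tr numeral_zero).
  by elim: n => // n IHn; rewrite iterS -IHn.
by rewrite [in RHS]/thead tnth_mktuple -trE.
Qed.

End Contexts.

Theorem theorem3 (m k : nat) (hm : 1 <= m)
    (R : ordinal_wmk m k -> ordinal_wmk m k -> Prop)
    (hlt : forall u v, ordinal_lt u v -> R u v)
    (hle : forall u v, R u v -> ordinal_le u v)
    (x y : nat) (hxy : x <> y) (i j : nat) :
  Sigma11_hard
    (codes (fun phi : form => in_language x y i j phi /\ satisfiable R phi)).
Proof.
move=> B [a Ha].
pose K := sigma11_registers a.
pose phi n := modal_sentence x y i K (FAnd (standard K) (sigma11_axioms a n)).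
have R_le u v : R u v -> ordinal_lt u v \/ u = v by case/hle; [left|right].
have K2 : 2 < K by rewrite leq_max.
exists (fun n => code (phi n)); split; first exact: recursive_sigma11_sentence.
move=> n; rewrite Ha; split=> [[X /sigma11_structure[f nf Hf]]|].
  exists (phi n); split=> //; split; first exact: language_modal_sentence.
  exact: (satisfiable_of_normal_structure hlt R_le hxy
    (@finite_ordinalK m k hm) (@finite_positionK m k hm) (@finite_ordinal_lt m k hm)
    (@finite_ordinal_initial m k hm) nf (registers_sigma11_axioms a n) K2 Hf).
(* Codes being injective, [psi] is the sentence for [n]. If no sets existed, its negation would be
   valid, against satisfiability. *)
case=> psi [[_ sat] /code_inj E]; move: sat; rewrite E => sat.
apply: NNPP => H; apply: sat => M w g _ Hphi; apply: H.
have [f [e [nf Hf]]] := normal_structure_of_truth hlt R_le (@ordinal_lt_trans m k)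
  (@ordinal_lt_wf m k) (@ordinal_lt_total m k) hxy K2 (registers_sigma11_axioms a n) Hphi.
exact: sigma11_of_structure nf Hf.
Qed.
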